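(* If $d$ is an integer at least $136$ then, for every non-negative real number $t$, $$ \Biggl|I_d(t)-\sqrt{\frac{6}{\pi}}\,e^{-6t^2}\biggl(1-\frac{3-72t^2+144t^4}{20d}\biggr)\Biggr|<\frac{1}{d^{3/2}}. $$
   Context: For a positive integer $d$ and a non-negative real number $t$, $I_d(t)$ denotes the $(d-1)$-dimensional volume of $H\cap[0,1]^d$ where $H$ is a hyperplane of $\mathbb{R}^d$ that is orthogonal to a diagonal of the hypercube $[0,1]^d$ (a segment joining two opposite vertices) and whose Euclidean distance to the center of $[0,1]^d$ is equal to $t$. By symmetry, this does not depend on the choice of such an $H$. The volume is $0$ when the intersection is empty. For $d\geq2$, one has $$ I_d(t)=\frac{2\sqrt{d}}{\pi}\int_{0}^{+\infty}\biggl(\frac{\sin u}{u}\biggr)^{d}\cos\bigl(2\sqrt{d}\,tu\bigr)\,du. $$ *)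

(* Defs.v *)
From HB Require Import structures.
From mathcomp Require Import all_boot all_order all_algebra.
From mathcomp Require Import all_classical all_reals all_analysis.
Set Implicit Arguments.
Unset Strict Implicit.
Unset Printing Implicit Defensive.
Import Order.TTheory GRing.Theory Num.Theory.
Import numFieldNormedType.Exports.
Local Open Scope classical_set_scope.
Local Open Scope ring_scope.

Section Defs.
Context {R : realType}.

(* Lebesgue measure on R^k, as a set function on k-tuples. *)
Fixpoint lebesgue_tuple (k : nat) : set (k.-tuple (measurableTypeR R)) -> \bar R :=
  match k return set (k.-tuple (measurableTypeR R)) -> \bar R with
  | 0 => dirac [tuple]
  | k'.+1 => pushforward
      (product_measure1 (@lebesgue_measure R) (@lebesgue_tuple k'))
      (fun z => [tuple of z.1 :: z.2])
  end.

Definition dot (n : nat) (x y : 'rV[R]_n) : R := \sum_i x 0 i * y 0 i.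

(* The library's norm on row vectors is the sup norm. *)
Definition euclidean_norm (n : nat) (x : 'rV[R]_n) : R := Num.sqrt (dot x x).

Definition euclidean_dist (n : nat) (x : 'rV[R]_n) (A : set 'rV[R]_n) : R :=
  inf [set euclidean_norm (x - y) | y in A].

Definition hypercube (n : nat) : set 'rV[R]_n :=
  [set x | forall i, 0 <= x 0 i <= 1].

Definition hypercube_center (n : nat) : 'rV[R]_n := const_mx (1 / 2).

Definition is_vertex (n : nat) (v : 'rV[R]_n) : Prop :=
  forall i, v 0 i = 0 \/ v 0 i = 1.

Definition opposite_vertices (n : nat) (v w : 'rV[R]_n) : Prop :=
  [/\ is_vertex v, is_vertex w & forall i, v 0 i <> w 0 i].

Definition orthogonal_to_diagonal (n : nat) (H : set 'rV[R]_n) : Prop :=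
  exists v w, opposite_vertices v w /\
    exists b : R, H = [set x | dot (w - v) x = b].

Definition affine_map (k n : nat) (p : 'rV[R]_n) (Q : 'M[R]_(k, n))
    (y : k.-tuple (measurableTypeR R)) : 'rV[R]_n :=
  p + (\row_i (tnth y i : R)) *m Q.

(* The rows of Q are orthonormal: affine_map p Q is an isometric
   parametrization of the k-dimensional affine subspace F. *)
Definition isometric_chart (k n : nat) (F : set 'rV[R]_n)
    (p : 'rV[R]_n) (Q : 'M[R]_(k, n)) : Prop :=
  Q *m Q^T = 1%:M /\ range (affine_map p Q) = F.

(* V is the k-dimensional volume of the subset A of the k-dimensional
   affine subspace F. *)
Definition is_volume_in (k n : nat) (F A : set 'rV[R]_n) (V : R) : Prop :=
  exists p (Q : 'M[R]_(k, n)), isometric_chart F p Q /\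
    lebesgue_tuple (affine_map p Q @^-1` A) = V%:E.

(* I_d(t): by symmetry, and by the invariance of the Lebesgue measure under
   isometries, exactly one V qualifies when 0 < d and 0 <= t. *)
Definition hypercube_section_volume (d : nat) (t : R) : R :=
  xget 0 [set V | exists H : set 'rV[R]_d,
    [/\ orthogonal_to_diagonal H,
        euclidean_dist (hypercube_center d) H = t &
        is_volume_in d.-1 H (H `&` @hypercube d) V]].

End Defs.

(* Main.v *)
Require Import Defs.
From HB Require Import structures.
From mathcomp Require Import all_boot all_order all_algebra.
From mathcomp Require Import fingroup perm.
From mathcomp Require Import all_classical all_reals all_analysis.
From mathcomp Require Import measurable_realfun.
From mathcomp Require Import ring lra zify.
Import Order.TTheory GRing.Theory Num.Theory.
Import numFieldNormedType.Exports.
Set Implicit Arguments.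
Unset Strict Implicit.
Unset Printing Implicit Defensive.
Local Open Scope classical_set_scope.
Local Open Scope ring_scope.

(** Let e be the sign vector of the diagonal to which H is orthogonal.  In the
    coordinates z_i = e_i (x_i - 1/2) the cube is [-1/2, 1/2]^d and H is the
    hyperplane where the z_i add up to s, with |s| = t sqrt d.  Forgetting one
    coordinate of a point of H divides (d-1)-dimensional volumes by sqrt d, so
    that I_d(t) = sqrt d * f(s), where f is the density of a sum of d
    independent uniform variables on [-1/2, 1/2].  This is [chart_volume]; as
    the isometric chart of H is arbitrary, it rests on the linear change of
    variables for the iterated Lebesgue measure, [scales_volume_unit], proved
    with an LUP decomposition.

    The density is an iterated convolution, and convolving with the indicator
    of [-1/2, 1/2] multiplies the cosine transform by sinc u = sin u / u
    ([fourier_convolution]).  Starting from the triangle function, whose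
    transform [integral_sinc2_cos] comes from the integrals of
    (1 - cos (a u)) / u^2, one gets
      I_d(t) = (2 sqrt d / pi) * int_0^oo (sinc u)^d cos (2 sqrt d t u) du.

    Finally, log (sinc u) = - u^2/6 - u^4/180 - O(u^6), so that (sinc u)^d is
    close to exp (- d u^2/6) (1 - d u^4/180).  The cosine transform of the
    latter is a combination of Gaussian moments and is exactly the announced
    approximation ([integral_edgeworth_cos]).  The error is at most the
    integral of an explicit majorant of the difference, which does not depend
    on t ([sinc_expn_edgeworth]).  Multiplied by 2 sqrt d / pi, that integral
    is less than 10 / d^2 plus an exponentially small term, whereas
    1 / d^(3/2) is sqrt d / d^2 and sqrt d > 11
    ([edgeworth_error_small]). *)

(** * Linear changes of variables for the iterated Lebesgue measure *)

Section LebesgueTuple.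
Context {R : realType}.
Notation mR := (measurableTypeR R).
Notation lam := (@lebesgue_measure R).

Lemma measurable_tuple_cons k :
  measurable_fun setT (fun z : mR * k.-tuple mR => [tuple of z.1 :: z.2]).
Proof. by apply: measurable_cons. Qed.

(** Stated as an existence so that the induction may use the product of
    Lebesgue measure with a sigma-finite measure before the iterated measure
    is known to be one. *)
Lemma lebesgue_tuple_is_measure k :
  exists m : {sigma_finite_measure set (k.-tuple mR) -> \bar R},
    @lebesgue_tuple R k = m.
Proof.
elim: k => [|k [m Em]].
  by exists (@dirac _ (0.-tuple mR) [tuple] R).
pose g := fun z : mR * k.-tuple mR => [tuple of z.1 :: z.2].
have mg : measurable_fun setT g by exact: measurable_tuple_cons.
pose gm := HB.pack_for {mfun (mR * k.-tuple mR)%type >-> (k.+1.-tuple mR)} g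
  (isMeasurableFun.Build _ _ _ _ g mg).
pose nu := pushforward (lam \x m)%E gm.
have sf : sigma_finite setT nu.
  have /sigma_finiteP[F [TF ndF Foo]] := sigma_finiteT lam.
  have /sigma_finiteP[G [TG ndG Goo]] := sigma_finiteT m.
  have mh := @measurable_tnth _ mR k.+1 ord0.
  have mb := @measurable_behead _ mR k.
  exists (fun n => [set t | F n (tnth t ord0)] `&`
                   [set t : k.+1.-tuple mR | G n [tuple of behead t]]).
    apply/seteqP; split=> // t _.
    have [i _ Fi] : (\bigcup_i F i) (tnth t ord0) by rewrite -TF.
    have [j _ Gj] : (\bigcup_i G i) [tuple of behead t] by rewrite -TG.
    exists (maxn i j) => //; split => /=.
      by move: (tnth t ord0) Fi; exact/subsetPset/ndF/leq_maxl.
    by move: Gj; move: [tuple of behead t]; exact/subsetPset/ndG/leq_maxr.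
  move=> n; have [mF Fn] := Foo n; have [mG Gn] := Goo n; split.
    apply: measurableI.
      by rewrite -[X in measurable X]setTI; exact: mh.
    by rewrite -[X in measurable X]setTI; exact: mb.
  rewrite /nu /pushforward [X in (_ X < _)%E](_ : _ = F n `*` G n); last first.
    apply/seteqP; split => -[x y] [/= Fx Gy]; split => //.
      by move: Gy; congr (G n _); exact/val_inj.
    by move: Gy; rewrite /=; congr (G n _); exact/val_inj.
  by rewrite product_measure1E// lte_mul_pinfty// ge0_fin_numE.
pose sfm := HB.pack_for {sigma_finite_measure set (k.+1.-tuple mR) -> \bar R} nu
  (Measure_isSigmaFinite.Build _ _ _ nu sf).
by exists (sfm mg mg mg); rewrite /= Em.
Qed.
Let lebesgue_tuple0 k : @lebesgue_tuple R k set0 = 0%E.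
Proof. by have [m ->] := @lebesgue_tuple_is_measure k. Qed.
Let lebesgue_tuple_ge0 k A : (0 <= @lebesgue_tuple R k A)%E.
Proof. by have [m ->] := @lebesgue_tuple_is_measure k. Qed.
Let lebesgue_tuple_sigma_additive k : semi_sigma_additive (@lebesgue_tuple R k).
Proof.
have [m ->] := @lebesgue_tuple_is_measure k; exact: measure_semi_sigma_additive.
Qed.
HB.instance Definition _ k := isMeasure.Build _ _ _ (@lebesgue_tuple R k)
  (lebesgue_tuple0 k) (@lebesgue_tuple_ge0 k) (@lebesgue_tuple_sigma_additive k).
Let lebesgue_tuple_sigma_finite k : sigma_finite setT (@lebesgue_tuple R k).
Proof. have [m ->] := @lebesgue_tuple_is_measure k; exact: sigma_finiteT. Qed.
HB.instance Definition _ k := Measure_isSigmaFinite.Build _ _ _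
  (@lebesgue_tuple R k) (@lebesgue_tuple_sigma_finite k).

(** The section of B at first coordinate x, in the curried form in which the
    recursion on dimension produces it. *)
Definition slice k (B : set (k.+1.-tuple mR)) (x : R) : set (k.-tuple mR) :=
  [set y : k.-tuple mR | B [tuple of x :: y]].

Let slice_xsection k (B : set (k.+1.-tuple mR)) x :
  slice B x = xsection ((fun z : mR * k.-tuple mR => [tuple of z.1 :: z.2]) @^-1` B) x.
Proof. by apply/seteqP; split => y /=; rewrite /xsection/= inE. Qed.

Lemma lebesgue_tupleS k (B : set (k.+1.-tuple mR)) :
  lebesgue_tuple B = (\int[lam]_x lebesgue_tuple (slice B x))%E.
Proof.
by apply: eq_integral => x _ /=; rewrite slice_xsection.
Qed.

Lemma measurable_slice k (B : set (k.+1.-tuple mR)) x :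
  measurable B -> measurable (slice B x).
Proof.
move=> mB; rewrite slice_xsection; apply: measurable_xsection.
by rewrite -[X in measurable X]setTI; exact: measurable_tuple_cons.
Qed.

Lemma measurable_fun_slice k (B : set (k.+1.-tuple mR)) : measurable B ->
  measurable_fun setT ((fun x => lebesgue_tuple (slice B x)) : mR -> \bar R).
Proof.
move=> mB; under eq_fun do rewrite slice_xsection.
apply: (@measurable_fun_xsection _ _ _ _ _ (@lebesgue_tuple R k)).
by rewrite -[X in measurable X]setTI; exact: measurable_tuple_cons.
Qed.

Definition box k (A : 'I_k -> set mR) : set (k.-tuple mR) :=
  [set t | forall i, A i (tnth t i)].

Lemma measurable_box k (A : 'I_k -> set mR) :
  (forall i, measurable (A i)) -> measurable (box A).
Proof.
move=> mA.
rewrite (_ : box A = \bigcap_(i in [set: 'I_k]) ((fun t => tnth t i) @^-1` A i)).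
  apply: fin_bigcap_measurable => // i _.
  by rewrite -[X in measurable X]setTI; exact: measurable_tnth.
by apply/seteqP; split => t /=; [move=> Bt i _; exact: Bt|move=> Bt i; exact: Bt].
Qed.

Lemma lebesgue_tuple_box k (A : 'I_k -> set mR) :
  (forall i, measurable (A i)) ->
  lebesgue_tuple (box A) = (\prod_i lam (A i))%E.
Proof.
elim: k A => [|k IH] A mA.
  rewrite big_ord0 /= diracE mem_set//=; by case.
rewrite lebesgue_tupleS big_ord_recl -IH; last by move=> i; exact: mA.
transitivity (\int[lam]_x ((\1_(A ord0) x)%:E *
    lebesgue_tuple (box (fun i => A (lift ord0 i)))))%E; last first.
  rewrite ge0_integralZr//; last exact/measurable_EFinP/measurable_indic.
  by rewrite integral_indic// setIT.
apply: eq_integral => x _; rewrite indicE.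
have [xA|xA] := boolP (x \in A ord0).
  rewrite mul1e; congr lebesgue_tuple; apply/seteqP; split => y /=.
    by move=> Ay i; have := Ay (lift ord0 i); rewrite tnthS.
  move=> Ay i; have [j ->|->] := unliftP ord0 i; first by rewrite tnthS; exact: Ay.
  by rewrite inE in xA.
rewrite mul0e (_ : slice _ _ = set0) ?measure0//; apply/seteqP; split=> // y /=.
by move=> /(_ ord0); move: xA; rewrite notin_setE.
Qed.
Let boxes k : set (set (k.-tuple mR)) :=
  [set B | exists2 A : 'I_k -> set mR, (forall i, measurable (A i)) & B = box A].

Let measurable_boxes k :
  @measurable _ (k.-tuple mR) = <<s @boxes k >>.
Proof.
apply/seteqP; split; last first.
  apply: smallest_sub; first exact: sigma_algebra_measurable.
  by move=> _ [A mA ->]; exact: measurable_box.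
apply: smallest_sub; first exact: smallest_sigma_algebra.
rewrite -bigcup_seq; apply: bigcup_sub => i _ _ [Y mY <-].
apply: sub_sigma_algebra; exists (fun j => if j == i then Y else setT).
  by move=> j; case: ifP.
rewrite setTI; apply/seteqP; split=> t /=.
  by move=> Yt j; case: eqVneq => // ->.
by move=> /(_ i); rewrite eqxx.
Qed.

(** Boxes form a generating pi-system, and bounded boxes exhaust the space. *)
Lemma lebesgue_tuple_unique k (nu : {measure set (k.-tuple mR) -> \bar R}) :
  (forall A : 'I_k -> set mR, (forall i, measurable (A i)) ->
     nu (box A) = (\prod_i lam (A i))%E) ->
  forall B, measurable B -> lebesgue_tuple B = nu B.
Proof.
move=> nuE B mB.
pose I n : set mR := `[- n%:R, n%:R]%classic.
apply: (measure_unique (@boxes k) (fun n => box (fun=> I n))) => //.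
- exact: measurable_boxes.
- move=> _ _ [A mA ->] [A' mA' ->]; exists (fun i => A i `&` A' i).
    by move=> i; exact: measurableI.
  by apply/seteqP; split => t /=;
    [move=> [h h'] i; split|move=> h; split => i; have [] := h i].
- by move=> n; exists (fun=> I n) => // i; exact: measurable_itv.
- apply/seteqP; split => // t _.
  exists (\max_(i < k) (Num.trunc `|tnth t i|).+1)%N => // i.
  rewrite /I /= in_itv/= -ler_norml.
  rewrite (le_trans (ltW (truncnS_gt _)))// ler_nat.
  exact: (leq_bigmax_cond (F := fun i => (Num.trunc `|tnth t i|).+1)).
- by move=> _ [A mA ->]; rewrite nuE// [LHS]lebesgue_tuple_box.
- move=> n; rewrite [ltLHS]lebesgue_tuple_box; last by move=> i; exact: measurable_itv.
  have If : lam (I n) \is a fin_num by rewrite lebesgue_measure_itv/=; case: ifP.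
  under eq_bigr do rewrite -(fineK If).
  by rewrite prodEFin ltry.
Qed.
(** Both sides are measures, so it is enough to compare them on the
    intervals ]u, v]. *)
Lemma lebesgue_measure_affine (a c : R) (B : set mR) : a != 0 -> measurable B ->
  lam ((fun x => a * x + c) @^-1` B) = (`|a|^-1%:E * lam B)%E.
Proof.
move=> a0 mB.
have mg : measurable_fun setT (fun x : mR => a * x + c : mR).
  by apply: measurable_funD => //; exact: measurable_funM.
have na : 0 <= `|a| by [].
suff -> : lam B = mscale (NngNum na) (pushforward lam (fun x : mR => a * x + c : mR)) B.
  by rewrite /mscale/= muleA -EFinM mulVf ?normr_eq0// mul1e.
move=> mg1; apply: lebesgue_measure_unique => //= _ [[u v] _ <-].
rewrite /mscale/= /pushforward lebesgue_measure_itv/= lte_fin.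
have [a_gt0|a_le0] := ltP 0 a.
  rewrite (_ : _ @^-1` _ = `](u - c) / a, (v - c) / a]%classic); last first.
    apply/seteqP; split => x /=; rewrite !in_itv/= ltr_pdivrMr// ler_pdivlMr//;
    by rewrite ltrBlDr lerBrDr mulrC.
  rewrite lebesgue_measure_itv/= lte_fin ltr_pM2r ?invr_gt0// ltrD2r.
  case: ifP => uv; last by rewrite mule0.
  by rewrite -EFinB -EFinM -mulrBl gtr0_norm// mulrCA divff// mulr1; congr EFin; ring.
have {}a_le0 : a < 0 by rewrite lt_neqAle a0.
rewrite (_ : _ @^-1` _ = `[(v - c) / a, (u - c) / a[%classic); last first.
  apply/seteqP; split => x /=; rewrite !in_itv/= ltr_ndivlMr// ler_ndivrMr//;
  by rewrite ltrBlDr lerBrDr (mulrC x) andbC.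
rewrite lebesgue_measure_itv/= lte_fin ltr_nM2r ?invr_lt0// ltrD2r.
case: ifP => uv; last by rewrite mule0.
by rewrite -EFinB -EFinM -mulrBl ltr0_norm// mulrCA mulNr divff// mulrN1; congr EFin; ring.
Qed.

Lemma integral_affine (a c : R) (f : mR -> \bar R) : a != 0 ->
  measurable_fun setT f -> (forall x, 0 <= f x)%E ->
  (\int[lam]_x f (a * x + c)%R = `|a|^-1%:E * \int[lam]_x f x)%E.
Proof.
move=> a0 mf f0.
have mg : measurable_fun setT (fun x : mR => a * x + c : mR).
  by apply: measurable_funD => //; exact: measurable_funM.
have na : 0 <= `|a|^-1 by rewrite invr_ge0.
have := @ge0_integral_pushforward _ _ _ _ R _ mg lam setT f measurableT mf (fun x _ => f0 x).
rewrite preimage_setT => <-.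
rewrite -(ge0_integral_mscale lam measurableT (NngNum na))//.
apply: eq_measure_integral => B mB _.
exact: lebesgue_measure_affine.
Qed.

Definition tuple_affine k (M : 'M[R]_k) (c : 'rV[R]_k) (y : k.-tuple mR) : k.-tuple mR :=
  [tuple ((\row_j (tnth y j : R)) *m M + c) 0 i | i < k].

Lemma measurable_tuple_affine k (M : 'M[R]_k) (c : 'rV[R]_k) :
  measurable_fun setT (tuple_affine M c).
Proof.
apply/measurable_fun_tnthP => i.
rewrite (_ : _ \o _ = fun y : k.-tuple mR => \sum_j tnth y j * M j i + c 0 i); last first.
  apply/funext => y /=; rewrite tnth_mktuple !mxE; congr (_ + _).
  by apply: eq_bigr => j _; rewrite mxE.
apply: measurable_funD => //; apply: measurable_sum => j.
by apply: measurable_funM => //; exact: measurable_tnth.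
Qed.

Lemma measurable_preimage_affine k (M : 'M[R]_k) (c : 'rV[R]_k) B :
  measurable B -> measurable (tuple_affine M c @^-1` B).
Proof.
by move=> mB; rewrite -[X in measurable X]setTI; exact: measurable_tuple_affine.
Qed.

(** The translation part is kept so that the property passes to slices in
    an induction on the dimension. *)
Definition scales_volume k (M : 'M[R]_k) := forall c B, measurable B ->
  lebesgue_tuple (tuple_affine M c @^-1` B) = (`|\det M|^-1%:E * lebesgue_tuple B)%E.

Lemma tuple_affineM k (M N : 'M[R]_k) (c : 'rV[R]_k) y :
  tuple_affine N c (tuple_affine M 0 y) = tuple_affine (M *m N) c y.
Proof.
apply: eq_from_tnth => i; rewrite !tnth_mktuple mulmxA.
congr ((_ *m _ + _) _ _); apply/rowP => j; rewrite [LHS]mxE tnth_mktuple.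
by rewrite addr0.
Qed.

Lemma scales_volumeM k (M N : 'M[R]_k) :
  scales_volume M -> scales_volume N -> scales_volume (M *m N).
Proof.
move=> sM sN c B mB.
rewrite (_ : _ @^-1` _ = tuple_affine M 0 @^-1` (tuple_affine N c @^-1` B)); last first.
  by apply/seteqP; split => y /=; rewrite tuple_affineM.
rewrite sM; last exact: measurable_preimage_affine.
by rewrite sN// muleA -EFinM det_mulmx normrM invfM.
Qed.
(** When the first column vanishes below the diagonal, the first
    coordinate transforms on its own, and it only shifts the others. *)
Lemma tuple_affine_upper k (M : 'M[R]_k.+1) c (x : mR) (y : k.-tuple mR) :
  (forall i, M (lift ord0 i) ord0 = 0) ->
  tuple_affine M c [tuple of x :: y] =
  [tuple of M ord0 ord0 * x + c 0 ord0 ::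
    tuple_affine (row' ord0 (col' ord0 M))
      (\row_j (M ord0 (lift ord0 j) * x + c 0 (lift ord0 j))) y].
Proof.
move=> M0; apply: eq_from_tnth => i; have [j ->|->] := unliftP ord0 i;
rewrite !(tnthS, tnth_mktuple) ?tnth0 !mxE big_ord_recl !mxE (mulrC x).
  rewrite [RHS]addrCA -addrA; congr +%R; congr +%R; apply: eq_bigr => l _.
  by rewrite !mxE tnthS.
by rewrite big1 ?addr0// => l _; rewrite M0 mulr0.
Qed.

Lemma det_first_col k (M : 'M[R]_k.+1) :
  (forall i, M (lift ord0 i) ord0 = 0) ->
  \det M = M ord0 ord0 * \det (row' ord0 (col' ord0 M)).
Proof.
move=> M0; rewrite (expand_det_col _ ord0) big_ord_recl big1 ?addr0.
  by rewrite /cofactor/= addn0 expr0 mul1r.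
by move=> i _; rewrite M0 mul0r.
Qed.

(** Fubini: on each slice the inner map is again upper triangular, up to a
    translation, and the first coordinate undergoes an affine map of the
    line. *)
Lemma scales_volume_upper k (M : 'M[R]_k) :
  (forall i j : 'I_k, (j < i)%N -> M i j = 0) -> \det M != 0 -> scales_volume M.
Proof.
elim: k M => [|k IH] M up dM c B mB.
  rewrite det_mx00 normr1 invr1 mul1e; congr lebesgue_tuple.
  by apply/seteqP; split => y /=; congr (B _); apply: eq_from_tnth => -[].
have M0 i : M (lift ord0 i) ord0 = 0 by apply: up.
move: dM; rewrite det_first_col// mulf_eq0 negb_or => /andP[a0 d0].
have sM' : scales_volume (row' ord0 (col' ord0 M)).
  by apply: IH => // i j ij; rewrite !mxE; apply: up.
rewrite lebesgue_tupleS normrM invfM EFinM -muleA.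
pose h x : \bar R := lebesgue_tuple (slice B x).
rewrite lebesgue_tupleS -/h.
rewrite (_ : (_ * \int[lam]_x _)%E = (\int[lam]_x (`|\det (row' ord0 (col' ord0 M))|^-1%:E * h x))%E); last first.
  by rewrite ge0_integralZl//; exact: measurable_fun_slice.
rewrite -(integral_affine (c 0 ord0) a0); last first.
- by move=> x; rewrite mule_ge0// lee_fin invr_ge0.
- by apply: measurable_funeM; exact: measurable_fun_slice.
apply: eq_integral => x _; rewrite /h -(sM' (\row_j (M ord0 (lift ord0 j) * x + c 0 (lift ord0 j)))).
  congr lebesgue_tuple; apply/seteqP.
  by split => y; rewrite /slice/= tuple_affine_upper.
exact: measurable_slice.
Qed.

Lemma tnth_tuple_affine_perm k (s : 'S_k) c y i :
  tnth (tuple_affine (perm_mx s) c y) (s i) = tnth y i + c 0 (s i).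
Proof.
rewrite tnth_mktuple !mxE; congr (_ + _).
rewrite (bigD1 i)//= !mxE eqxx mulr1 big1 ?addr0// => j ji.
by rewrite !mxE (inj_eq perm_inj) (negbTE ji) mulr0.
Qed.

(** A permutation of the coordinates permutes the factors of the volume of
    a box. *)
Lemma scales_volume_perm k (s : 'S_k) : scales_volume (perm_mx s).
Proof.
move=> c B mB; rewrite det_perm normrX normrN1 expr1n invr1 mul1e.
have mg := @measurable_tuple_affine k (perm_mx s) c.
apply/esym; apply: (lebesgue_tuple_unique (nu := pushforward (@lebesgue_tuple R k) _)) => //.
move=> A mA; rewrite /= /pushforward.
pose A' i : set mR := (fun x => 1 * x + c 0 (s i)) @^-1` A (s i).
rewrite (_ : _ @^-1` _ = box A'); last first.
  apply/seteqP; split => y /= Ay i; rewrite /A'/=.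
    by rewrite mul1r -tnth_tuple_affine_perm.
  rewrite -(permKV s i) tnth_tuple_affine_perm.
  by have := Ay ((s^-1)%g i); rewrite /A'/= mul1r.
have mA' i : measurable (A' i).
  rewrite -[X in measurable X]setTI.
  have : measurable_fun setT (fun x : mR => 1 * x + c 0 (s i) : mR).
    by apply: measurable_funD => //; exact: measurable_funM.
  exact.
rewrite lebesgue_tuple_box// [RHS](reindex_inj (@perm_inj _ s))/=.
apply: eq_bigr => i _; rewrite lebesgue_measure_affine ?oner_neq0//.
by rewrite normr1 invr1 mul1e.
Qed.

(** Reversing the order of the coordinates makes the matrix upper
    triangular. *)
Lemma scales_volume_lower k (M : 'M[R]_k) :
  (forall i j : 'I_k, (i < j)%N -> M i j = 0) -> \det M != 0 -> scales_volume M.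
Proof.
move=> low dM; pose s := perm (@rev_ord_inj k).
have sK : perm_mx s *m perm_mx s = 1%:M :> 'M[R]_k.
  rewrite -perm_mxM (_ : s * s = 1)%g ?perm_mx1//.
  by apply/permP => i; rewrite permM !permE rev_ordK.
have -> : M = perm_mx s *m ((perm_mx s *m M *m perm_mx s) *m perm_mx s).
  by rewrite -!mulmxA sK mulmx1 mulmxA sK mul1mx.
apply: scales_volumeM; first exact: scales_volume_perm.
apply: scales_volumeM; last exact: scales_volume_perm.
apply: scales_volume_upper => [i j ji|].
  have sV : (s^-1 = s)%g.
    by apply/permP => l; apply: (@perm_inj _ s); rewrite permKV !permE rev_ordK.
  rewrite -[X in _ *m perm_mx X]sV -col_permE -row_permE !mxE low// !permE/=.
  by move: (ltn_ord i) (ltn_ord j) ji; lia.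
by rewrite !det_mulmx mulrAC -det_mulmx sK det1 mul1r.
Qed.

(** The change of variables follows from the triangular and permutation
    cases by the LUP decomposition. *)
Theorem scales_volume_unit k (M : 'M[R]_k) : \det M != 0 -> scales_volume M.
Proof.
case: k M => [|k] M dM; first by apply: scales_volume_upper => // -[].
have := cormen_lup_correct M; have := cormen_lup_perm M; have := cormen_lup_lower M.
have := cormen_lup_upper M; have := cormen_lup_detL M.
case: (cormen_lup M) => [[P L] U] /= dL up low /is_perm_mxP[s ->] E.
have ME : M = perm_mx s^-1 *m (L *m U).
  by rewrite [L *m U](_ : _ = perm_mx s *m M) // mulmxA -perm_mxM mulVg perm_mx1 mul1mx.
rewrite ME; apply: scales_volumeM; first exact: scales_volume_perm.
move: dM; rewrite ME !det_mulmx !mulf_eq0 !negb_or => /and3P[_ dL0 dU0].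
apply: scales_volumeM.
  apply: scales_volume_lower => // i j ij; rewrite low ?(ltnW ij)//.
  by rewrite -(inj_eq val_inj) (ltn_eqF ij).
exact: scales_volume_upper.
Qed.

(** * Sections of the centred cube *)

(** The points of a section of the centred cube by the hyperplane on which
    the coordinates add up to s, seen through all its coordinates but one: the
    missing coordinate is s minus the sum of the others. *)
Definition cube_slab k (s : R) : set (k.-tuple mR) :=
  [set z | (forall i, `|tnth z i : R| <= 1 / 2) /\ `|s - \sum_i (tnth z i : R)| <= 1 / 2].

Lemma measurable_cube_slab k s : measurable (@cube_slab k s).
Proof.
have mI : measurable ([set x | `|x| <= 1 / 2] : set mR).
  rewrite (_ : [set x | _] = `[- (1 / 2), 1 / 2]%classic).
    exact: measurable_itv.
  by apply/seteqP; split => x /=; rewrite in_itv/= ler_norml.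
rewrite (_ : cube_slab s = box (fun=> [set x | `|x| <= 1 / 2]) `&`
  (fun z => s - \sum_i tnth z i) @^-1` [set x : mR | `|x| <= 1 / 2]).
  apply: measurableI; first exact: measurable_box.
  have : measurable_fun setT (fun z : k.-tuple mR => s - \sum_i tnth z i : mR).
    apply: measurable_funB => //; apply: measurable_sum => i; exact: measurable_tnth.
  by move=> h; rewrite -[X in measurable X]setTI; exact: h.
by apply/seteqP; split.
Qed.

Lemma slice_cube_slab k s x : slice (@cube_slab k.+1 s) x =
  if `|x| <= 1 / 2 then cube_slab (s - x) else set0.
Proof.
have E (y : k.-tuple mR) : s - \sum_i (tnth [tuple of x :: y] i : R) = s - x - \sum_i (tnth y i : R).
  by rewrite big_ord_recl/= opprD addrA; congr (_ - _ - _); apply: eq_bigr => i _; rewrite tnthS.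
case: ifPn => x2; apply/seteqP; split => y //=.
- move=> [yx ys]; split; last by rewrite -E.
  by move=> i; have := yx (lift ord0 i); rewrite tnthS.
- move=> [yx ys]; split; last by rewrite E.
  by move=> i; have [j ->|->] := unliftP ord0 i; rewrite ?tnthS.
- by move=> [/(_ ord0)/=]; rewrite (negbTE x2).
Qed.

(** As a function of s, the volume of [cube_slab] in dimension k.+1 is the
    convolution of the one in dimension k with the indicator of
    [-1/2, 1/2]. *)
Lemma lebesgue_cube_slabS k s : lebesgue_tuple (@cube_slab k.+1 s) =
  (\int[lam]_(x in `[(- (1 / 2))%R, (1 / 2)%R]) lebesgue_tuple (@cube_slab k (s - x)))%E.
Proof.
rewrite lebesgue_tupleS [RHS]integral_mkcond; apply: eq_integral => x _.
rewrite slice_cube_slab patchE mem_setE in_itv/= -ler_norml; by case: ifP => // _; rewrite measure0.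

Qed.

(** The base case is the triangle function, the density of a sum of two
    uniform variables. *)
Lemma lebesgue_cube_slab1 s :
  lebesgue_tuple (@cube_slab 1 s) = (Num.max 0 (1 - `|s|))%:E.
Proof.
rewrite lebesgue_cube_slabS.
pose a : R := Num.max (- (1 / 2)) (s - 1 / 2); pose b : R := Num.min (1 / 2) (s + 1 / 2).
transitivity (lam `[a, b]).
  rewrite -[`[a, b]%classic]setIT -integral_indic ?setIT//= integral_mkcond; apply: eq_integral => x _.
  rewrite patchE mem_setE in_itv/= diracE indicE mem_setE in_itv/= /a /b.
  rewrite ge_max le_min.
  have -> : ([tuple] \in @cube_slab 0 (s - x)) = (s - 1 / 2 <= x <= s + 1 / 2).
    apply/idP/idP.
      by move/set_mem => -[_]; rewrite big_ord0 subr0 ler_norml; lra.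
    by move=> h; apply/mem_set; split; [case|rewrite big_ord0 subr0 ler_norml; lra].
  by rewrite andbACA; case: (_ <= _ <= _).
rewrite lebesgue_measure_itv/= lte_fin /a /b.
rewrite -EFinB -[0%E]/(0%R%:E) -(fun_if EFin); congr EFin.
rewrite /Num.max /Num.min.
have [s0|s0] := ger0P s; do !case: ifPn; rewrite -?leNgt => *; lra.
Qed.
End LebesgueTuple.

(** * Integrals on the half-line and the kernel (1 - cos (a u)) / u^2 *)

Section HalfLine.
Context {R : realType}.
Notation lam := (@lebesgue_measure R).
Notation pos := (`]0%R, +oo[%classic : set (measurableTypeR R)).
Implicit Types (f g F : R -> R) (a b x y l u : R).

(** A constant rather than a notation, so that the quantified statement is
    not taken for a type class premise. *)
Definition antiderivative F f := forall x, is_derive x 1 F (f x).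

Lemma is_derive_continuous F x df : is_derive x 1 F df -> {for x, continuous F}.
Proof.
by move=> [dF _]; apply: differentiable_continuous; exact/derivable1_diffP.
Qed.

Lemma antiderivative_continuous F f : antiderivative F f -> continuous F.
Proof. by move=> dF x; exact: is_derive_continuous (dF x). Qed.

Lemma integral_derive_ge0 F f l :
  (forall x, 0 <= x -> 0 <= f x) -> continuous f ->
  antiderivative F f -> F x @[x --> +oo] --> l ->
  (\int[lam]_(x in pos) (f x)%:E = (l - F 0)%:E)%E.
Proof.
move=> f0 cf dF Fl.
rewrite integral_itv_obnd_cbnd; last first.
  apply/measurable_EFinP; apply: measurable_funTS; exact: continuous_measurable_fun.
rewrite (ge0_continuous_FTC2y f0 _ Fl) ?EFinB//.
- exact: continuous_subspaceT.
- by move=> x _; have [] := dF x.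
- by apply: cvg_at_right_filter; exact: (antiderivative_continuous dF).
- by move=> x _; rewrite derive1E; have [] := dF x.
Qed.

(** The integrals over ]0, n] converge by domination, and they are computed
    by the fundamental theorem on segments. *)
Lemma integral_derive F f l :
  lam.-integrable pos (EFin \o f) -> continuous f ->
  antiderivative F f -> F x @[x --> +oo] --> l ->
  \int[lam]_(x in pos) f x = l - F 0.
Proof.
move=> fi cf dF Fl.
have mf : measurable_fun setT (EFin \o f).
  by apply/measurable_EFinP; exact: continuous_measurable_fun.
pose I n : set R := `]0, n.+1%:R]%classic.
have E n : (\int[lam]_(x in I n) (f x)%:E = (F n.+1%:R - F 0)%:E)%E.
  rewrite integral_itv_obnd_cbnd; last exact: measurable_funTS.
  rewrite (@continuous_FTC2 _ f F) ?EFinB//.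
  - exact: continuous_subspaceT.
  - split.
    + by move=> x _; have [] := dF x.
    + by apply: cvg_at_right_filter; exact: (antiderivative_continuous dF).
    + by apply: cvg_at_left_filter; exact: (antiderivative_continuous dF).
  - by move=> x _; rewrite derive1E; have [] := dF x.
have mI n : measurable (I n) by exact: measurable_itv.
have Isub n : I n `<=` pos by move=> x; rewrite /I/= !in_itv/= andbT => /andP[].
have c1 : (\int[lam]_(x in pos) ((EFin \o f) \_ (I n)) x @[n --> \oo] -->
          \int[lam]_(x in pos) (f x)%:E)%E.
  apply: (@dominated_cvg _ _ _ lam pos (measurable_itv _)
    (fun n => (EFin \o f) \_ (I n)) (EFin \o f) (fun x => `|f x|%:E)) => //.
  - move=> n; apply: measurable_funTS.
    by apply: (iffLR (measurable_restrictT _ (mI n))); exact: measurable_funTS.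
  - move=> x; rewrite /= in_itv/= andbT => x0.
    apply: cvg_near_cst; near=> n; rewrite patchE mem_set// /I/= in_itv/= x0/=.
    near: n; exists (Num.trunc `|x|) => // n /= xn.
    rewrite (le_trans (ler_norm _))// (le_trans (ltW (truncnS_gt _)))// ler_nat.
    by rewrite ltnS.
  - by move: fi => /integrable_norm/=.
  - move=> n x _; rewrite patchE; case: ifPn => _; first by rewrite lee_fin.
    by rewrite abse0 lee_fin.
have c2 : ((F n.+1%:R - F 0)%:E @[n --> \oo] --> (l - F 0)%:E)%E.
  apply: cvg_EFin; first exact: nearW.
  apply: cvgB; last exact: cvg_cst.
  have : F n%:R @[n --> \oo] --> l by move/cvg_pinftyP : Fl; apply; exact: cvgr_idn.
  by rewrite -(cvg_shiftS (fun n => F n%:R)).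
rewrite /Rintegral; have -> : (\int[lam]_(x in pos) (f x)%:E = (l - F 0)%:E)%E.
  apply: (cvg_unique _ c1) => //=; apply: cvg_trans c2.
  apply: near_eq_cvg; near=> n; rewrite -E -integral_mkcondr.
  by congr (integral _ _ _); apply/esym/setIidPr; exact: Isub.
by [].
Unshelve. all: end_near. Qed.

Lemma integral_inv_1Dsqr :
  (\int[lam]_(x in pos) ((1 + x ^+ 2)^-1)%:E = (pi / 2)%:E)%E.
Proof.
rewrite (@integral_derive_ge0 atan _ (pi / 2)).
- by rewrite atan0 subr0.
- by move=> x _; rewrite invr_ge0 addr_ge0// sqr_ge0.
- move=> x; apply: cvgV; last first.
    apply: cvgD; first exact: cvg_cst.
    exact: exprn_continuous.
  by rewrite gt_eqF// ltr_pwDl// sqr_ge0.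
- by move=> x; exact: is_derive1_atan.
- exact: cvgy_atan.
Qed.

Lemma integrable_inv_1Dsqr k :
  lam.-integrable pos (fun x => (k / (1 + x ^+ 2))%:E).
Proof.
rewrite (_ : (fun x => _) = (fun x : R => k%:E * ((1 + x ^+ 2)^-1)%:E)%E)//.
apply: (@integrableZl _ _ _ lam pos _ k (fun x => ((1 + x ^+ 2)^-1)%:E)) => //.
apply/integrableP; split.
  apply/measurable_EFinP; apply: measurable_funTS.
  apply: continuous_measurable_fun => x; apply: cvgV; last first.
    apply: cvgD; first exact: cvg_cst.
    exact: exprn_continuous.
  by rewrite gt_eqF// ltr_pwDl// sqr_ge0.
under eq_integral do rewrite /= ger0_norm ?invr_ge0 ?addr_ge0 ?sqr_ge0//.
by rewrite integral_inv_1Dsqr ltry.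
Qed.

(** The majorant 1 / (1 + x^2) suits functions that are bounded near 0 and
    decay like 1 / x^2, such as the powers of sinc, and its integral is
    known. *)
Lemma integrable_dominated f k :
  measurable_fun pos f -> (forall x, 0 < x -> `|f x| <= k / (1 + x ^+ 2)) ->
  lam.-integrable pos (EFin \o f).
Proof.
move=> mf fk; apply: (le_integrable _ _ _ (integrable_inv_1Dsqr k)) => //.
- exact/measurable_EFinP.
- move=> x /=; rewrite in_itv/= andbT => x0.
  by rewrite lee_fin (le_trans (fk x x0))// ler_norm.
Qed.
Lemma cvg0_dominated F k :
  (forall x, 0 < x -> `|F x| <= k / x) -> F x @[x --> +oo] --> 0.
Proof.
move=> Fk; apply/cvgrPdist_le => e e0; near=> x.
have x0 : 0 < x by near: x; exact: nbhs_pinfty_gt.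
rewrite sub0r normrN (le_trans (Fk x x0))// ler_pdivrMr// mulrC.
rewrite -ler_pdivrMr//; near: x; apply: nbhs_pinfty_ge; exact: num_real.
Unshelve. all: end_near. Qed.

Lemma expRN_le_inv x : 0 < x -> expR (- x) <= x^-1.
Proof.
move=> x0; rewrite expRN lef_pV2 ?posrE ?expR_gt0//.
by rewrite (le_trans _ (expR_ge1Dx x))// lerDr.
Qed.

(** One of the two inner integrals when the order of integration is
    exchanged in [integral_one_minus_cos_gt0]; [laplace_linear] is the
    other. *)
Lemma laplace_one_minus_cos a x : a != 0 -> 0 < x ->
  (\int[lam]_(u in pos) (x * (1 - cos (a * u)) * expR (- (u * x)))%:E =
   (a ^+ 2 / (x ^+ 2 + a ^+ 2))%:E)%E.
Proof.
move=> a0 x0; have s0 : 0 < x ^+ 2 + a ^+ 2 by rewrite ltr_pwDl ?exprn_gt0 ?sqr_ge0.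
(* The antiderivative vanishing at infinity. *)
pose F u := expR (- (u * x)) *
  ((x ^+ 2 * cos (a * u) - a * x * sin (a * u)) / (x ^+ 2 + a ^+ 2) - 1).
rewrite (@integral_derive_ge0 F _ 0).
- rewrite /F !(mulr0,mul0r) oppr0 expR0 cos0 sin0 mul1r mulr0 subr0 mulr1 sub0r.
  by congr EFin; field; rewrite gt_eqF.
- move=> u u0; rewrite !mulr_ge0 ?expR_ge0 ?(ltW x0)// subr_ge0; exact: cos_le1.
- by move=> u; apply: is_derive_continuous.
- move=> u; rewrite /F; apply: is_derive_eq.
  by rewrite /GRing.scale/=; field; rewrite gt_eqF.
- apply: (@cvg0_dominated _ (((x ^+ 2 + `|a| * x) / (x ^+ 2 + a ^+ 2) + 1) / x)) => u u0.
  rewrite -mulrA -invfM mulrC (mulrC x) /F normrM ger0_norm ?expR_ge0//.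
  apply: ler_pM => //; [by apply: expRN_le_inv; rewrite mulr_gt0|].
  rewrite (le_trans (ler_normB _ _))// normr1 lerD2r normrM [X in _ * X]gtr0_norm ?invr_gt0//.
  rewrite ler_pM2r ?invr_gt0// (le_trans (ler_normB _ _))// lerD//.
    rewrite normrM ger0_norm ?sqr_ge0// ler_piMr ?sqr_ge0// ler_norml cos_geN1 cos_le1//.
  rewrite !normrM (gtr0_norm x0) ler_piMr ?mulr_ge0// ?(ltW x0)//.
  by rewrite ler_norml sin_geN1 sin_le1.
Qed.

Lemma laplace_linear u : 0 < u ->
  (\int[lam]_(x in pos) (x * expR (- (u * x)))%:E = (u ^- 2)%:E)%E.
Proof.
move=> u0.
pose F x := - ((x / u + u ^- 2) * expR (- (u * x))).
rewrite (@integral_derive_ge0 F _ 0).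
- by rewrite /F !(mulr0,mul0r) oppr0 expR0 add0r mulr1 opprK add0r.
- by move=> x x0; rewrite mulr_ge0 ?expR_ge0.
- by move=> x; apply: is_derive_continuous.
- move=> x; rewrite /F; apply: is_derive_eq.
  by rewrite /GRing.scale/=; field; rewrite gt_eqF.
- have c0 : expR (- (u * x)) @[x --> +oo] --> (0:R).
    apply: (@cvg0_dominated _ u^-1) => x x0; rewrite ger0_norm ?expR_ge0// -invfM.
    by apply: expRN_le_inv; rewrite mulr_gt0.
  apply: (@cvg0_dominated _ (2 * u ^- 3 + u ^- 3)) => x x0.
  rewrite /F normrN ger0_norm ?mulr_ge0 ?addr_ge0 ?expR_ge0 ?invr_ge0 ?divr_ge0 ?exprn_ge0 ?(ltW u0) ?(ltW x0)//.
  rewrite 2!mulrDl; apply: lerD.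
    rewrite expRN; have xu := mulr_gt0 u0 x0.
    have := @expR_ge1Dxn _ (u * x) 1 (ltW xu).
    rewrite (_ : 2`!%:R = 2)// => h.
    rewrite ler_pdivrMr ?expR_gt0//.
    rewrite (le_trans _ (ler_wpM2l _ (le_trans (_ : (u * x) ^+ 2 / 2 <= 1 + (u * x) ^+ 2 / 2) h)))//.
    - rewrite le_eqVlt; apply/orP; left; apply/eqP.
      by field; rewrite !gt_eqF.
    - by rewrite divr_ge0 ?mulr_ge0 ?invr_ge0 ?exprn_ge0 ?(ltW u0) ?(ltW x0).
    - by rewrite lerDr.
  rewrite (_ : u ^- 3 / x = u ^- 2 / (u * x)); last by field; rewrite !gt_eqF.
  by rewrite ler_pM2l ?invr_gt0 ?exprn_gt0//; apply: expRN_le_inv; rewrite mulr_gt0.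
Qed.

(** Since u^-2 is the integral of x exp (- u x) over x > 0, exchanging the
    integrals turns the left-hand side into the integral of
    a^2 / (x^2 + a^2), an arctangent.  The integrand is nonnegative, so
    Tonelli applies and no conditionally convergent integral is met. *)
Lemma integral_one_minus_cos_gt0 a : 0 < a ->
  (\int[lam]_(u in pos) ((1 - cos (a * u)) / u ^+ 2)%:E = (pi * a / 2)%:E)%E.
Proof.
move=> a0.
have a1 : a != 0 by rewrite gt_eqF.
(* The integrand on the plane, extended by 0 outside the quadrant. *)
pose h (z : measurableTypeR R * measurableTypeR R) : R :=
  \1_pos z.1 * \1_pos z.2 * (z.2 * (1 - cos (a * z.1)) * expR (- (z.1 * z.2))).
have mh : measurable_fun setT (EFin \o h).
  apply/measurable_EFinP.
  have m1 : measurable_fun setT (fun z : measurableTypeR R * measurableTypeR R => z.1) by exact: measurable_fst.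
  have m2 : measurable_fun setT (fun z : measurableTypeR R * measurableTypeR R => z.2) by exact: measurable_snd.
  have mi : measurable_fun setT (\1_pos : measurableTypeR R -> measurableTypeR R).
    by apply: measurable_indic.
  have mc : measurable_fun setT (cos : measurableTypeR R -> measurableTypeR R).
    by apply: continuous_measurable_fun; exact: continuous_cos.
  have me : measurable_fun setT (expR : measurableTypeR R -> measurableTypeR R).
    by apply: continuous_measurable_fun; exact: continuous_expR.
  apply: measurable_funM.
    by apply: measurable_funM; [exact: (measurableT_comp mi m1)|exact: (measurableT_comp mi m2)].
  apply: measurable_funM.
    apply: measurable_funM => //; apply: measurable_funB => //.
    by apply: (measurableT_comp mc); exact: measurable_funM.
  apply: (measurableT_comp me); apply: measurableT_comp => //; exact: measurable_funM.
have h0 z : (0 <= (EFin \o h) z)%E.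
  rewrite lee_fin /h; rewrite !indicE; case: (z.1 \in pos); last by rewrite !mul0r.
  case: (boolP (z.2 \in pos)) => [|_]; last by rewrite mulr0 mul0r.
  move=> /set_mem/=; rewrite in_itv/= andbT => /ltW z0; rewrite !mul1r.
  by apply: mulr_ge0; [apply: mulr_ge0 => //; rewrite subr_ge0 cos_le1|exact: expR_ge0].
have := fubini_tonelli (m1 := lam) (m2 := lam) (EFin \o h) mh h0.
rewrite (_ : (\int[_]_x \int[_]_y _)%E = (\int[lam]_(u in pos) ((1 - cos (a * u)) / u ^+ 2)%:E)%E).
  move=> ->; transitivity (\int[lam]_(x in pos) (a ^+ 2 / (x ^+ 2 + a ^+ 2))%:E)%E.
    rewrite [RHS]integral_mkcond; apply: eq_integral => x _; rewrite patchE.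
    case: ifPn => xp; last first.
      rewrite integral0_eq// => u _; rewrite /h/= !indicE (negbTE xp).
      by rewrite mulr0 mul0r.
    have x0 : 0 < x by move/set_mem : xp; rewrite /= in_itv/= andbT.
    rewrite -(laplace_one_minus_cos a1 x0) [RHS]integral_mkcond.
    apply: eq_integral => u _; rewrite patchE /h/= !indicE xp mulr1.
    by case: ifP => _; rewrite ?mul1r ?mul0r.
  rewrite (@integral_derive_ge0 (fun x => a * atan (x / a)) _ (a * (pi / 2))).
  - by rewrite mul0r atan0 mulr0 subr0; congr EFin; ring.
  - by move=> x _; rewrite divr_ge0 ?sqr_ge0// addr_ge0 ?sqr_ge0.
  - move=> x; apply: cvgM; first exact: cvg_cst.
    apply: cvgV; first by rewrite gt_eqF// ltr_wpDl ?sqr_ge0 ?exprn_gt0.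
    apply: cvgD; [exact: exprn_continuous|exact: cvg_cst].
  - move=> x; apply: is_derive_eq.
    rewrite /GRing.scale/=; field.
    by rewrite a1 !gt_eqF ?ltr_wpDl ?ltr_pwDl ?sqr_ge0 ?exprn_gt0.
  - apply: cvgM; first exact: cvg_cst.
    suff h1 : x / a @[x --> +oo] --> +oo%R by exact: (cvg_comp (fun x => x / a) atan h1 (cvgy_atan (R := R))).
    apply/cvgryPge => M; near=> x; rewrite ler_pdivlMr//.
rewrite [RHS]integral_mkcond; apply: eq_integral => u _; rewrite patchE.
case: ifPn => up; last first.
  by rewrite integral0_eq// => x _; rewrite /h/= !indicE (negbTE up) !mul0r.
have u0 : 0 < u by move/set_mem : up; rewrite /= in_itv/= andbT.
rewrite EFinM -(laplace_linear u0) -ge0_integralZl//; last 2 first.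
- apply/measurable_EFinP; apply: measurable_funTS; apply: continuous_measurable_fun.
  by move=> x; apply: is_derive_continuous.
- move=> x; rewrite /= in_itv/= andbT => /ltW x0.
  by rewrite lee_fin mulr_ge0// expR_ge0.
rewrite [RHS]integral_mkcond.
apply: eq_integral => x _; rewrite patchE /h/= !indicE up mul1r.
case: ifP => _; rewrite ?mul1r ?mul0r//= -EFinM; congr EFin.
by rewrite mulrAC mulrC mulrA.
Unshelve. all: end_near. Qed.

Lemma integral_one_minus_cos a :
  (\int[lam]_(u in pos) ((1 - cos (a * u)) / u ^+ 2)%:E = (pi * `|a| / 2)%:E)%E.
Proof.
have [->|a0] := eqVneq a 0.
  rewrite normr0 mulr0 mul0r integral0_eq// => x _.
  by rewrite mul0r cos0 subrr mul0r.
rewrite -integral_one_minus_cos_gt0 ?normr_gt0//; apply: eq_integral => u _.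
by case: (ger0P a) => // _; rewrite mulNr cosN.
Qed.

(** * Bounds on sinc *)

Lemma antiderivative_ge0 F f : antiderivative F f -> F 0 = 0 ->
  (forall x, 0 <= x -> 0 <= f x) -> forall x, 0 <= x -> 0 <= F x.
Proof.
move=> dF F0 f0 x x0.
have [z _||c] := @MVT_segment _ F f 0 x x0.
- exact: dF.
- by apply: continuous_subspaceT; exact: antiderivative_continuous dF.
rewrite in_itv/= => /andP[c0 _] /eqP; rewrite F0 !subr0 => /eqP ->.
by rewrite mulr_ge0// f0.
Qed.

(** Each bound is integrated from the previous one, starting from
    cos <= 1. *)
Lemma sin_cos_taylor : forall x, 0 <= x ->
  [/\ sin x <= x, x - x ^+ 3 / 6 <= sin x,
      sin x <= x - x ^+ 3 / 6 + x ^+ 5 / 120 &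
      x - x ^+ 3 / 6 + x ^+ 5 / 120 - x ^+ 7 / 1000 <= sin x].
Proof.
have c0 (x : R) : 0 <= x -> 0 <= 1 - cos x by rewrite subr_ge0 cos_le1.
have s1 x : 0 <= x -> 0 <= x - sin x.
  apply: (@antiderivative_ge0 (fun x => x - sin x) (fun x => 1 - cos x)); [move=> z| |exact: c0].
    exact: is_derive_eq.
  by rewrite sin0 subrr.
have c2 x : 0 <= x -> 0 <= cos x - (1 - x ^+ 2 / 2).
  apply: (@antiderivative_ge0 (fun x => cos x - (1 - x ^+ 2 / 2)) (fun x => x - sin x)); [move=> z| |exact: s1].
    by apply: is_derive_eq; rewrite /GRing.scale/=; field.
  by rewrite cos0 expr0n mul0r subr0 subrr.
have s3 x : 0 <= x -> 0 <= sin x - (x - x ^+ 3 / 6).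
  apply: (@antiderivative_ge0 (fun x => sin x - (x - x ^+ 3 / 6)) (fun x => cos x - (1 - x ^+ 2 / 2))); [move=> z| |exact: c2].
    by apply: is_derive_eq; rewrite /GRing.scale/=; field.
  by rewrite sin0 expr0n mul0r !subr0.
have c4 x : 0 <= x -> 0 <= 1 - x ^+ 2 / 2 + x ^+ 4 / 24 - cos x.
  apply: (@antiderivative_ge0 (fun x => 1 - x ^+ 2 / 2 + x ^+ 4 / 24 - cos x) (fun x => sin x - (x - x ^+ 3 / 6))); [move=> z| |exact: s3].
    by apply: is_derive_eq; rewrite /GRing.scale/=; field.
  by rewrite cos0 !expr0n !mul0r subr0 addr0 subrr.
have s5 x : 0 <= x -> 0 <= x - x ^+ 3 / 6 + x ^+ 5 / 120 - sin x.
  apply: (@antiderivative_ge0 (fun x => x - x ^+ 3 / 6 + x ^+ 5 / 120 - sin x) (fun x => 1 - x ^+ 2 / 2 + x ^+ 4 / 24 - cos x)); [move=> z| |exact: c4].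
    by apply: is_derive_eq; rewrite /GRing.scale/=; field.
  by rewrite sin0 !expr0n !mul0r !subr0 addr0.
(* Here k6 is 1/6! and k7 is 1/7!. *)
have [k6 k6E] : exists k : R, 6 * k = 120^-1 by exists (120^-1 / 6); rewrite mulrC divfK.
have [k7 k7E] : exists k : R, 7 * k = k6 by exists (k6 / 7); rewrite mulrC divfK.
have c6 x : 0 <= x -> 0 <= cos x - (1 - x ^+ 2 / 2 + x ^+ 4 / 24 - k6 * x ^+ 6).
  apply: (@antiderivative_ge0
      (fun x => cos x - (1 - x ^+ 2 / 2 + x ^+ 4 / 24 - k6 * x ^+ 6))
      (fun x => x - x ^+ 3 / 6 + x ^+ 5 / 120 - sin x)); [move=> z| |exact: s5].
    by apply: is_derive_eq; rewrite /GRing.scale/= -k6E; field.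
  by rewrite cos0 !expr0n !mul0r mulr0 !subr0 addr0 subrr.
have s7 x : 0 <= x -> 0 <= sin x - (x - x ^+ 3 / 6 + x ^+ 5 / 120 - k7 * x ^+ 7).
  apply: (@antiderivative_ge0
      (fun x => sin x - (x - x ^+ 3 / 6 + x ^+ 5 / 120 - k7 * x ^+ 7))
      (fun x => cos x - (1 - x ^+ 2 / 2 + x ^+ 4 / 24 - k6 * x ^+ 6)));
    [move=> z| |exact: c6].
    by apply: is_derive_eq; rewrite /GRing.scale/= -k7E; field.
  by rewrite sin0 !expr0n !mul0r mulr0 !(subr0, addr0).
have k7_le : k7 <= 1 / 1000 by lra.
move=> x x0; split; rewrite -subr_ge0; [exact: s1|exact: s3|exact: s5|].
rewrite (le_trans (s7 x x0))// lerD2l lerN2 lerD2l lerN2 [leRHS]mulrC.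
by rewrite ler_wpM2r ?exprn_ge0//; lra.
Qed.

(** Obtained like [sin_cos_taylor], starting from 1 - x <= exp (- x). *)
Lemma expRN_taylor : forall x, 0 <= x ->
  expR (- x) <= 1 - x + x ^+ 2 / 2 /\
  1 - x + x ^+ 2 / 2 - x ^+ 3 / 6 <= expR (- x).
Proof.
have e1 (x : R) : 0 <= x -> 0 <= expR (- x) - (1 - x).
  by move=> _; rewrite subr_ge0; exact: expR_ge1Dx.
have e2 x : 0 <= x -> 0 <= 1 - x + x ^+ 2 / 2 - expR (- x).
  apply: (@antiderivative_ge0 (fun x => 1 - x + x ^+ 2 / 2 - expR (- x)) (fun x => expR (- x) - (1 - x))); [move=> z| |exact: e1].
    by apply: is_derive_eq; rewrite /GRing.scale/=; field.
  by rewrite oppr0 expR0 !expr0n !mul0r !addr0 subrr.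
have e3 x : 0 <= x -> 0 <= expR (- x) - (1 - x + x ^+ 2 / 2 - x ^+ 3 / 6).
  apply: (@antiderivative_ge0 (fun x => expR (- x) - (1 - x + x ^+ 2 / 2 - x ^+ 3 / 6)) (fun x => 1 - x + x ^+ 2 / 2 - expR (- x))); [move=> z| |exact: e2].
    by apply: is_derive_eq; rewrite /GRing.scale/=; field.
  by rewrite oppr0 expR0 !expr0n !mul0r oppr0 !addr0 subrr.
by move=> x x0; split; rewrite -subr_ge0; [exact: e2|exact: e3].
Qed.
Definition sinc (u : R) := sin u / u.

Lemma sinc_taylor u : 0 < u ->
  [/\ sinc u <= 1 - u ^+ 2 / 6 + (u ^+ 2) ^+ 2 / 120, 1 - u ^+ 2 / 6 <= sinc u &
      1 - u ^+ 2 / 6 + (u ^+ 2) ^+ 2 / 120 - (u ^+ 2) ^+ 3 / 1000 <= sinc u].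
Proof.
move=> u0; have [_ s3 s5 s7] := sin_cos_taylor (ltW u0).
rewrite /sinc; split.
- rewrite ler_pdivrMr//; apply: le_trans s5 _.
  by rewrite le_eqVlt; apply/orP; left; apply/eqP; field.
- rewrite ler_pdivlMr//; apply: le_trans s3.
  by rewrite le_eqVlt; apply/orP; left; apply/eqP; field.
- rewrite ler_pdivlMr//; apply: le_trans s7.
  rewrite le_eqVlt; apply/orP; left; apply/eqP.
  by move: (1000^-1) => k; field.
Qed.

Lemma normr_sinc_le_inv u : 0 < u -> `|sinc u| <= u^-1.
Proof.
move=> u0; rewrite /sinc normrM [X in _ * X]gtr0_norm ?invr_gt0// ler_piMl ?invr_ge0 ?(ltW u0)//.
by rewrite ler_norml sin_geN1 sin_le1.
Qed.

Lemma normr_sinc_le1 u : 0 < u -> `|sinc u| <= 1.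
Proof.
move=> u0; have [u1|u1] := leP u 1; last first.
  by rewrite (le_trans (normr_sinc_le_inv u0))// invf_le1 ?(ltW u1).
have [s1 _ _ _] := sin_cos_taylor (ltW u0); have [_ s3 _] := sinc_taylor u0.
rewrite ler_norml {2}/sinc ler_pdivrMr// mul1r s1 andbT (le_trans _ s3)//.
have : u ^+ 2 <= 1 by rewrite exprn_ile1 ?(ltW u0).
by lra.
Qed.

(** This follows from |sinc u| <= min (1, 1 / u). *)
Lemma sinc2_le u : 0 < u -> sinc u ^+ 2 <= 2 / (1 + u ^+ 2).
Proof.
move=> u0; rewrite -real_normK ?num_real// ler_pdivlMr ?ltr_pwDl ?sqr_ge0//.
have h1 : `|sinc u| ^+ 2 <= 1 by rewrite exprn_ile1 ?normr_sinc_le1.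
have h2 : `|sinc u| ^+ 2 * u ^+ 2 <= 1.
  rewrite -exprMn exprn_ile1 ?mulr_ge0 ?(ltW u0)//.
  by rewrite -ler_pdivlMr// div1r normr_sinc_le_inv.
by rewrite mulrDr mulr1 (_ : 2 = 1 + 1)// lerD.
Qed.

(** For 1 <= u <= 2 the Taylor bound is a quadratic in u^2, convex, hence
    below the larger of its values at the end points, and 1 / u takes over
    beyond 2. *)
Lemma normr_sinc_le_17_20 u : 1 <= u -> `|sinc u| <= 17 / 20.
Proof.
move=> u1; have u0 : 0 < u by exact: lt_le_trans u1.
have [u2|u2] := leP u 2; last first.
  rewrite (le_trans (normr_sinc_le_inv u0))// (le_trans (_ : _ <= 2^-1))//.
    by rewrite lef_pV2 ?posrE// ltW.
  by lra.
have [s5 s3 _] := sinc_taylor u0.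
have w1 : 1 <= u ^+ 2 by rewrite exprn_ege1.
have w4 : u ^+ 2 <= 4.
  by rewrite (_ : 4 = 2 ^+ 2) ?lerXn2r ?nnegrE ?(ltW u0)// -natrX.
move: s5 s3 w1 w4; set w := u ^+ 2 => s5 s3 w1 w4.
rewrite ler_norml; apply/andP; split; first by lra.
by apply: le_trans s5 _; nra.
Qed.

(** The exponent is the Taylor polynomial of log (sinc u) of degree 4, all
    further terms of which are negative. *)
Lemma sinc_le_expR u : 0 < u -> u <= 1 ->
  sinc u <= expR (- (u ^+ 2 / 6 + u ^+ 4 / 180)).
Proof.
move=> u0 u1; have [s5 _ _] := sinc_taylor u0; apply: le_trans s5 _.
have w0 : 0 <= u ^+ 2 by rewrite sqr_ge0.
have w1 : u ^+ 2 <= 1 by rewrite exprn_ile1 ?(ltW u0).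
rewrite (exprM u 2 2); move: w0 w1; set w := u ^+ 2 => w0 w1.
have x0 : 0 <= w / 6 + w ^+ 2 / 180 by rewrite addr_ge0 ?divr_ge0 ?sqr_ge0.
have [_] := expRN_taylor x0; apply: le_trans; rewrite -subr_ge0.
rewrite (_ : _ - _ = w ^+ 3 * ((1 + w / 60) / 15 / 72 - ((1 + w / 30) / 6) ^+ 3 / 6)).
  apply: mulr_ge0; first exact: exprn_ge0.
  rewrite subr_ge0.
  have : ((1 + w / 30) / 6) ^+ 3 <= (31 / 180) ^+ 3.
    by rewrite lerXn2r ?nnegrE; lra.
  rewrite [(31 / 180) ^+ 3](_ : _ = 31 / 180 * (31 / 180) * (31 / 180)); last by rewrite exprS expr2 mulrA.
  by move: (_ ^+ 3) => e; lra.
by field.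
Qed.

(** The true coefficient of u^6 in - log (sinc u) is 1/2835; the larger
    1/75 makes the bound hold on the whole of [0, 1]. *)
Lemma expR_le_sinc u : 0 < u -> u <= 1 ->
  expR (- (u ^+ 2 / 6 + u ^+ 4 / 180 + u ^+ 6 / 75)) <= sinc u.
Proof.
move=> u0 u1; have [_ _ s7] := sinc_taylor u0; apply: le_trans s7.
have w0 : 0 <= u ^+ 2 by rewrite sqr_ge0.
have w1 : u ^+ 2 <= 1 by rewrite exprn_ile1 ?(ltW u0).
rewrite (exprM u 2 2) (exprM u 2 3); move: w0 w1; set w := u ^+ 2 => w0 w1.
set X := w / 6 + _ + _.
have x0 : 0 <= X.
  rewrite /X; apply: addr_ge0; [apply: addr_ge0|]; apply: divr_ge0 => //; exact: exprn_ge0.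
have [+ _] := expRN_taylor x0; move=> h; apply: le_trans h _.
(* X = (w / 6) (1 + w v), so that X^2 / 2 is a multiple of w^2. *)
pose v := 1 / 30 + 2 * w / 25.
have v0 : 0 <= v by rewrite /v; lra.
have v1 : v <= 1 / 8 by rewrite /v; lra.
have XE : X = w / 6 * (1 + w * v) by rewrite /X /v; field.
rewrite -subr_ge0.
rewrite (_ : _ - _ = w ^+ 3 * (1 / 75 - 1 / 1000 - (2 * v + w * v ^+ 2) / 72)).
  apply: mulr_ge0; first exact: exprn_ge0.
  rewrite subr_ge0.
  have : w * v ^+ 2 <= 1 / 64 by nra.
  lra.
rewrite {1}/X XE /v.
by move: (1000^-1) => k; field.
Qed.
(** The Gaussian exp (- d u^2/6) with the first correction coming from the
    term - u^4/180 of log (sinc u). *)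
Definition edgeworth (d : nat) (u : R) :=
  expR (- (d%:R * u ^+ 2 / 6)) * (1 - d%:R * u ^+ 4 / 180).

(** The first summand controls u <= 1, the last one the decay of sinc for
    u >= 1; it is written so as to be integrable over the whole half-line
    without splitting it. *)
Definition edgeworth_error (d : nat) (u : R) :=
  expR (- (d%:R * u ^+ 2 / 6)) *
    (d%:R * u ^+ 6 / 75 + (d%:R * u ^+ 4 / 180) ^+ 2 / 2) +
  (17 / 20) ^+ (d - 2) * 2 / (1 + u ^+ 2).

(** Write y = d u^4/180 and z = d u^6/75.  For u <= 1 the bounds on sinc
    squeeze (sinc u)^d between the Gaussian times exp (- y - z) and the
    Gaussian times exp (- y).  For u >= 1 both terms are small: d - 2 factors
    of the power are at most 17/20 and the other two at most
    2 / (1 + u^2), while the correction 1 + y is at most z because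
    1/136 + 1/180 <= 1/75. *)
Lemma sinc_expn_edgeworth d (u : R) : (136 <= d)%N -> 0 < u ->
  `|sinc u ^+ d - edgeworth d u| <= edgeworth_error d u.
Proof.
move=> hd u0; rewrite /edgeworth /edgeworth_error.
set E := expR _; set D : R := d%:R.
have D136 : 136 <= D by rewrite /D ler_nat.
set y := D * u ^+ 4 / 180; set z := D * u ^+ 6 / 75.
have E0 : 0 < E by exact: expR_gt0.
have D0 : 0 <= D by lra.
have y0 : 0 <= y by rewrite /y divr_ge0 ?mulr_ge0 ?exprn_ge0 ?(ltW u0).
have z0 : 0 <= z by rewrite /z divr_ge0 ?mulr_ge0 ?exprn_ge0 ?(ltW u0).
have q0 : 0 <= (17 / 20 : R) by lra.
have t0 : 0 <= (17 / 20) ^+ (d - 2) * 2 / (1 + u ^+ 2).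
  by rewrite divr_ge0 ?mulr_ge0 ?exprn_ge0 ?addr_ge0 ?sqr_ge0.
have [u1|u1] := leP u 1.
  apply: le_trans (_ : _ <= E * (z + y ^+ 2 / 2)) _; last by rewrite lerDl.
  have up : sinc u ^+ d <= E * expR (- y).
    rewrite (le_trans (lerXn2r d _ _ (sinc_le_expR u0 u1)))//.
    - by rewrite nnegrE (le_trans (expR_ge0 _) (expR_le_sinc u0 u1)).
    - by rewrite nnegrE expR_ge0.
    - by rewrite -expRM_natl -expRD /y le_eqVlt; apply/orP; left; apply/eqP; congr expR; rewrite -/D; field.
  have lo : E * expR (- (y + z)) <= sinc u ^+ d.
    apply: (le_trans _ (lerXn2r d _ _ (expR_le_sinc u0 u1))).
    - by rewrite -expRM_natl -expRD /y /z le_eqVlt; apply/orP; left; apply/eqP; congr expR; rewrite -/D; field.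
    - by rewrite nnegrE expR_ge0.
    - by rewrite nnegrE (le_trans (expR_ge0 _) (expR_le_sinc u0 u1)).
  have [e2 _] := expRN_taylor y0.
  have e1 : 1 - (y + z) <= expR (- (y + z)) by exact: expR_ge1Dx.
  move: (ler_wpM2l (ltW E0) e2) (ler_wpM2l (ltW E0) e1) => h2 h1.
  have y20 : 0 <= E * (y ^+ 2 / 2) by rewrite mulr_ge0 ?divr_ge0 ?sqr_ge0 ?(ltW E0).
  have Ez0 : 0 <= E * z by rewrite mulr_ge0 ?(ltW E0).
  rewrite ler_norml; move: up lo h1 h2 y20 Ez0; rewrite !(mulrDr E) !(mulrN E) mulr1; lra.
rewrite (le_trans (ler_normB _ _))// addrC lerD//.
  rewrite normrM gtr0_norm// ler_wpM2l ?(ltW E0)//.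
  rewrite (le_trans (ler_normB _ _))// normr1 (ger0_norm y0).
  apply: le_trans (_ : _ <= z) _; last by rewrite lerDl divr_ge0 ?sqr_ge0.
  have w1 : 1 <= u ^+ 2 by rewrite exprn_ege1 ?ltW.
  have v1 : 1 <= u ^+ 4 by rewrite exprn_ege1 ?ltW.
  rewrite /y /z (exprD u 2 4); move: w1 v1; set w := u ^+ 2; set v := u ^+ 4 => w1 v1.
  have h1 : 136 <= D * v by rewrite -[136]mulr1 ler_pM.
  have h2 : D * v <= D * w * v by rewrite ler_wpM2r ?ler_peMr//; lra.
  by rewrite (mulrA D w v); lra.
rewrite normrX -{1}(subnK (leq_trans (isT : (2 <= 136)%N) hd)) exprD -mulrA.
apply: ler_pM; rewrite ?exprn_ge0//.
  by rewrite lerXn2r ?nnegrE// normr_sinc_le_17_20// ltW.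
by rewrite real_normK ?num_real// sinc2_le.
Qed.
Lemma integrable_realD f g : lam.-integrable pos (EFin \o f) ->
  lam.-integrable pos (EFin \o g) ->
  lam.-integrable pos (EFin \o (fun u => f u + g u)).
Proof.
by move=> fi gi; have := @integrableD _ _ _ lam _ (measurable_itv _) _ _ fi gi.
Qed.

Lemma integrable_realZ a f : lam.-integrable pos (EFin \o f) ->
  lam.-integrable pos (EFin \o (fun u => a * f u)).
Proof.
by move=> fi; have := @integrableZl _ _ _ lam _ (measurable_itv _) a _ fi.
Qed.

(** * The cosine transforms of the powers of sinc *)

Lemma measurable_sinc : measurable_fun pos sinc.
Proof.
apply: open_continuous_measurable_fun; first exact: interval_open.
move=> u; rewrite inE/= in_itv/= andbT => u0; apply: cvgM; first exact: continuous_sin.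
by apply: cvgV; rewrite ?gt_eqF.
Qed.

Lemma measurable_cosM b : measurable_fun pos (fun u => cos (b * u)).
Proof.
apply: measurable_funTS; apply: continuous_measurable_fun => u.
by apply: is_derive_continuous.
Qed.

Lemma integrable_sinc_cos n b :
  lam.-integrable pos (EFin \o (fun u => sinc u ^+ n.+2 * cos (b * u))).
Proof.
apply: (@integrable_dominated _ 2).
  apply: measurable_funM; last exact: measurable_cosM.
  by apply: measurable_funX; exact: measurable_sinc.
move=> u u0; rewrite normrM (le_trans (ler_piMr _ (_ : _ <= 1)))//.
  by rewrite ler_norml cos_geN1 cos_le1.
rewrite -addn2 exprD normrM (le_trans (ler_piMl _ (_ : _ <= 1)))//.
  by rewrite normrX exprn_ile1// normr_sinc_le1.
by rewrite ger0_norm ?sqr_ge0// sinc2_le.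
Qed.

(** Product formulas write sinc^2 times a cosine as a combination of three
    functions (1 - cos (a u)) / u^2. *)
Lemma integral_sinc2_cos s :
  \int[lam]_(u in pos) (sinc u ^+ 2 * cos (2 * s * u)) = pi / 2 * Num.max 0 (1 - `|s|).
Proof.
pose k a u : R := (1 - cos (a * u)) / u ^+ 2.
have mk a : measurable_fun pos (k a).
  apply: open_continuous_measurable_fun; first exact: interval_open.
  move=> u; rewrite inE/= in_itv/= andbT => u0; apply: cvgM.
    suff : {for u, continuous (fun x => 1 - cos (a * x))} by exact.
    exact: is_derive_continuous.
  apply: cvgV; first by rewrite gt_eqF ?exprn_gt0.
  exact: exprn_continuous.
have k0 a u : 0 <= k a u by rewrite divr_ge0 ?sqr_ge0// subr_ge0 cos_le1.
have ik a : lam.-integrable pos (EFin \o k a).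
  apply/integrableP; split; first exact/measurable_EFinP.
  under eq_integral do rewrite /= ger0_norm//.
  by rewrite integral_one_minus_cos ltry.
have Ik a : \int[lam]_(u in pos) k a u = pi * `|a| / 2.
  by rewrite /Rintegral integral_one_minus_cos.
rewrite (@eq_Rintegral _ _ _ lam _ (fun u =>
    4^-1 * (k (2 * (s + 1)) u + k (2 * (s - 1)) u) - 2^-1 * k (2 * s) u)); last first.
  move=> u; rewrite inE/= in_itv/= andbT => u0; rewrite /k /sinc.
  rewrite (_ : 2 * (s + 1) * u = 2 * s * u + (u + u)); last by ring.
  rewrite (_ : 2 * (s - 1) * u = 2 * s * u - (u + u)); last by ring.
  rewrite cosD cosB [cos (u + u)]cosD -!expr2 cos2sin2.
  by field; rewrite gt_eqF.
rewrite RintegralB//; last 2 first.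
- by apply: integrable_realZ; exact: integrable_realD.
- exact: integrable_realZ.
rewrite RintegralZl//; last exact: integrable_realD.
rewrite RintegralZl// RintegralD// !Ik !normrM (ger0_norm (_ : 0 <= 2))//.
transitivity (pi / 2 * ((`|s + 1| + `|s - 1|) / 2 - `|s|)); first by field.
congr (_ * _); rewrite /Num.max.
by case: (ger0P (s + 1)) => h1; case: (ger0P (s - 1)) => h2; case: (ger0P s) => h3;
  case: ifPn; rewrite -?leNgt => h4; lra.
Qed.
Notation half_itv := (`[(- (1 / 2))%R, (1 / 2)%R]%classic : set (measurableTypeR R)).

(** The cosine transform of the indicator of [-1/2, 1/2] is sinc. *)
Lemma integral_cos_shift (s u : R) : 0 < u ->
  (\int[lam]_(x in half_itv) (cos (2 * (s - x) * u))%:E = (cos (2 * s * u) * sinc u)%:E)%E.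
Proof.
move=> u0.
pose F x := - sin (2 * (s - x) * u) / (2 * u).
have dF : antiderivative F (fun x => cos (2 * (s - x) * u)).
  move=> x; rewrite /F; apply: is_derive_eq.
  by rewrite /GRing.scale/=; field; rewrite gt_eqF.
rewrite (@continuous_FTC2 _ _ F).
- rewrite /F -EFinB; congr EFin; rewrite /sinc.
  rewrite (_ : 2 * (s - 1 / 2) * u = 2 * s * u - u); last by field.
  rewrite (_ : 2 * (s - - (1 / 2)) * u = 2 * s * u + u); last by field.
  by rewrite sinB sinD; field; rewrite gt_eqF.
- by lra.
- by apply: continuous_subspaceT => x; apply: is_derive_continuous.
- split.
  + by move=> x _; have [] := dF x.
  + by apply: cvg_at_right_filter; exact: (antiderivative_continuous dF).
  + by apply: cvg_at_left_filter; exact: (antiderivative_continuous dF).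
- by move=> x _; rewrite derive1E; have [] := dF x.
Qed.

(** Fubini applies because sinc^(n+2) is integrable; the inner integral is
    [integral_cos_shift]. *)
Lemma fourier_convolution c n s :
  (\int[lam]_(x in half_itv) (c * \int[lam]_(u in pos) (sinc u ^+ n.+2 * cos (2 * (s - x) * u)))%R%:E
   = (c * \int[lam]_(u in pos) (sinc u ^+ n.+3 * cos (2 * s * u)))%R%:E)%E.
Proof.
pose w : measurableTypeR R -> R := (fun u => sinc u ^+ n.+2) \_ pos.
have wE u : w u = if u \in pos then sinc u ^+ n.+2 else 0 by rewrite /w patchE.
have mw : measurable_fun setT w.
  apply: (iffLR (measurable_restrictT _ (measurable_itv _))).
  by apply: measurable_funX; exact: measurable_sinc.
have iw : lam.-integrable pos (EFin \o (fun u => sinc u ^+ n.+2)).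
  have := integrable_sinc_cos n 0; congr (integrable _ _ _).
  by apply/funext => u /=; rewrite mul0r cos0 mulr1.
pose h (z : measurableTypeR R * measurableTypeR R) : R :=
  \1_half_itv z.1 * (w z.2 * cos (2 * (s - z.1) * z.2)).
have mh : measurable_fun setT (EFin \o h).
  apply/measurable_EFinP.
  have m1 : measurable_fun setT (fun z : measurableTypeR R * measurableTypeR R => z.1) by exact: measurable_fst.
  have m2 : measurable_fun setT (fun z : measurableTypeR R * measurableTypeR R => z.2) by exact: measurable_snd.
  have mi : measurable_fun setT (\1_half_itv : measurableTypeR R -> measurableTypeR R).
    by apply: measurable_indic.
  have mc : measurable_fun setT (cos : measurableTypeR R -> measurableTypeR R).
    by apply: continuous_measurable_fun; exact: continuous_cos.
  apply: measurable_funM; first exact: (measurableT_comp mi m1).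
  apply: measurable_funM; first exact: (measurableT_comp mw m2).
  apply: (measurableT_comp mc); apply: measurable_funM => //.
  by apply: measurable_funM => //; exact: measurable_funB.
have ih : (lam \x lam)%E.-integrable setT (EFin \o h).
  apply/(integrable12ltyP lam lam mh).
  apply: (@le_lt_trans _ _ (\int[lam]_x ((\1_half_itv x)%:E *
     \int[lam]_(u in pos) `|sinc u ^+ n.+2|%:E))%E).
    apply: ge0_le_integral => //.
    - by move=> x _; exact: integral_ge0.
    - apply: (@measurable_fun_fubini_tonelli_F _ _ _ _ _ lam (abse \o (EFin \o h))).
      + exact: measurableT_comp mh.
      + by move=> z; exact: abse_ge0.
    - apply: emeasurable_funM => //.
      by apply/measurable_EFinP; exact: measurable_indic.
    move=> x _; rewrite [leLHS]/= indicE; case: (boolP (x \in half_itv)) => xI; last first.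
      by rewrite mul0e integral0_eq// => u _; rewrite /h/= indicE (negbTE xI) mul0r normr0.
    rewrite mul1e [leRHS]integral_mkcond.
    apply: ge0_le_integral => //.
    - apply/measurable_EFinP; apply: measurableT_comp => //.
      have mh1 : measurable_fun setT h by exact/measurable_EFinP.
      exact: (measurableT_comp mh1 (pair1_measurable x)).
    - apply: (iffLR (measurable_restrictT _ (measurable_itv _))).
      by apply/measurable_EFinP; apply: measurableT_comp => //; apply: measurable_funX; exact: measurable_sinc.
    move=> u _; rewrite /h/= indicE xI mul1r patchE wE.
    case: ifP => _; last by rewrite mul0r normr0.
    by rewrite lee_fin normrM ler_piMr// ler_norml cos_geN1 cos_le1.
  rewrite ge0_integralZr//.
  - rewrite integral_indic// setIT [X in (X * _)%E]lebesgue_measure_itv/= ifT; last by rewrite lte_fin; lra.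
    apply: lte_mul_pinfty; first by rewrite -EFinB lee_fin; lra.
      by [].
    by case/integrableP : iw.
  - by apply/measurable_EFinP; exact: measurable_indic.
  - exact: integral_ge0.
pose G x := (\int[lam]_(u in pos) (sinc u ^+ n.+2 * cos (2 * (s - x) * u)))%R.
have hG x : (\int[lam]_u (EFin \o h) (x, u) = ((EFin \o G) \_ half_itv) x)%E.
  rewrite patchE /h/= indicE; case: ifPn => xI; last first.
    by rewrite integral0_eq// => u _; rewrite mul0r.
  rewrite /G /Rintegral fineK; last first.
    apply: integrable_fin_num => //; exact: integrable_sinc_cos.
  rewrite [RHS]integral_mkcond; apply: eq_integral => u _.
  by rewrite mul1r patchE wE; case: ifP => //; rewrite mul0r.
have iG : lam.-integrable half_itv (EFin \o G).
  apply: (iffRL (@integrable_mkcond _ _ _ lam _ (EFin \o G) (measurable_itv _))).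
  by have := integrable_fubini_F ih; congr (integrable _ _ _); apply/funext => x; exact: hG.
under eq_integral do rewrite EFinM.
rewrite (@integralZl _ _ _ lam _ (measurable_itv _) _ iG c) EFinM; congr (_ * _)%E.
transitivity (\int[lam]_x \int[lam]_u (EFin \o h) (x, u))%E.
  by rewrite [LHS]integral_mkcond; apply: eq_integral => x _; rewrite hG.
rewrite (Fubini ih) /Rintegral fineK; last first.
  apply: integrable_fin_num => //; exact: integrable_sinc_cos.
rewrite [RHS]integral_mkcond; apply: eq_integral => u _.
rewrite patchE; case: ifPn => up; last first.
  by rewrite integral0_eq// => x _; rewrite /h/= wE (negbTE up) mul0r mulr0.
have u0 : 0 < u by move/set_mem : up; rewrite /= in_itv/= andbT.
transitivity ((sinc u ^+ n.+2)%:E * \int[lam]_(x in half_itv) (cos (2 * (s - x) * u))%:E)%E; last first.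
  by rewrite integral_cos_shift// -EFinM (exprSr _ n.+2) mulrA mulrAC.
rewrite -integralZl//; last first.
  apply: continuous_compact_integrable; first exact: segment_compact.
  by apply: continuous_subspaceT => x; apply: is_derive_continuous.
rewrite [RHS]integral_mkcond; apply: eq_integral => x _.
rewrite patchE /h/= indicE wE up; case: ifP => _; first by rewrite mul1r.
by rewrite mul0r.
Qed.
End HalfLine.

(** * Cosine transforms of Gaussian moments *)

Section Gaussian.
Context {R : realType}.
Notation lam := (@lebesgue_measure R).
Notation pos := (`]0%R, +oo[%classic : set (measurableTypeR R)).
Implicit Types (f g F : R -> R) (b x y l u : R).
Variable a : R.
Hypothesis a_gt0 : 0 < a.

(** This is x^m <= m! exp x at x = a u^2. *)
Lemma even_powerM_gauss_le m u : u ^+ m.*2 * expR (- (a * u ^+ 2)) <= m`!%:R / a ^+ m.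
Proof.
have x0 : 0 <= a * u ^+ 2 by rewrite mulr_ge0 ?sqr_ge0 ?(ltW a_gt0).
have e0 := expR_gt0 (a * u ^+ 2).
rewrite expRN ler_pdivrMr// mulrAC ler_pdivlMr ?exprn_gt0// -muln2 mulnC exprM -exprMn mulrC.
case: m => [|m]; first by rewrite mul1r expr0 -expR0 ler_expR.
have := expR_ge1Dxn m x0; set f := (m.+1)`!%:R => h.
have f0 : 0 < f by rewrite ltr0n fact_gt0.
have {h} : (a * u ^+ 2) ^+ m.+1 / f <= expR (a * u ^+ 2).
  by apply: le_trans h; move: (_ / f) => q; lra.
by rewrite ler_pdivrMr// [leRHS]mulrC.
Qed.

Lemma powerM_gauss_dominated n :
  exists k, forall u, 0 < u -> `|u ^+ n * expR (- (a * u ^+ 2))| <= k / (1 + u ^+ 2).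
Proof.
(* (1 + u^2) u^n is at most 2 + u^(2 n) + u^(2 (n + 2)). *)
exists (2 + n`!%:R / a ^+ n + (n.+2)`!%:R / a ^+ n.+2) => u u0.
rewrite ger0_norm ?mulr_ge0 ?exprn_ge0 ?expR_ge0 ?(ltW u0)//.
rewrite ler_pdivlMr ?ltr_pwDl ?sqr_ge0//.
set e := expR _; have e0 : 0 <= e by exact: expR_ge0.
have e1 : e <= 1 by rewrite /e -expR0 ler_expR oppr_le0 mulr_ge0 ?sqr_ge0 ?(ltW a_gt0).
have aux (t : R) : t <= 1 + t ^+ 2 by nra.
have pow m : u ^+ m * e <= 1 + m`!%:R / a ^+ m.
  rewrite (le_trans (ler_wpM2r e0 (aux (u ^+ m))))// mulrDl mul1r lerD//.
  by rewrite -exprM muln2 even_powerM_gauss_le.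
rewrite mulrDr mulr1 mulrAC -exprD addn2.
have := pow n; have := pow n.+2; lra.
Qed.

Lemma continuous_realD f g : continuous f -> continuous g ->
  continuous (fun u : R => f u + g u).
Proof. by move=> cf cg u; apply: cvgD; [exact: cf|exact: cg]. Qed.

Lemma continuous_realZ x f : continuous f -> continuous (fun u : R => x * f u).
Proof. by move=> cf u; apply: cvgM; [exact: cvg_cst|exact: cf]. Qed.

Lemma continuous_gaussM n f : continuous f ->
  continuous (fun u : R => u ^+ n * expR (- (a * u ^+ 2)) * f u).
Proof.
move=> cf u; apply: cvgM; last exact: cf.
apply: cvgM; first exact: exprn_continuous.
suff : {for u, continuous (fun u : R => expR (- (a * u ^+ 2)))} by exact.
exact: is_derive_continuous.
Qed.

Lemma continuous_cosM b : continuous (fun u : R => cos (b * u)).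
Proof. by move=> u; apply: is_derive_continuous. Qed.

Lemma continuous_sinM b : continuous (fun u : R => sin (b * u)).
Proof. by move=> u; apply: is_derive_continuous. Qed.

Lemma integrable_gauss n f : continuous f -> (forall u, `|f u| <= 1) ->
  lam.-integrable pos (EFin \o (fun u => u ^+ n * expR (- (a * u ^+ 2)) * f u)).
Proof.
move=> cf f1; have [k kP] := powerM_gauss_dominated n.
apply: (integrable_dominated (k := k)).
  by apply: measurable_funTS; apply: continuous_measurable_fun; exact: continuous_gaussM.
move=> u u0; rewrite normrM (le_trans (ler_piMr _ (f1 u)))//; exact: kP.
Qed.

Definition gauss_cos n b := \int[lam]_(u in pos) (u ^+ n * expR (- (a * u ^+ 2)) * cos (b * u)).
Definition gauss_sin n b := \int[lam]_(u in pos) (u ^+ n * expR (- (a * u ^+ 2)) * sin (b * u)).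

Lemma integrable_gauss_cos n b : lam.-integrable pos
  (EFin \o (fun u => u ^+ n * expR (- (a * u ^+ 2)) * cos (b * u))).
Proof.
apply: integrable_gauss; first exact: continuous_cosM.
by move=> u; rewrite ler_norml cos_geN1 cos_le1.
Qed.

Lemma integrable_gauss_sin n b : lam.-integrable pos
  (EFin \o (fun u => u ^+ n * expR (- (a * u ^+ 2)) * sin (b * u))).
Proof.
apply: integrable_gauss; first exact: continuous_sinM.
by move=> u; rewrite ler_norml sin_geN1 sin_le1.
Qed.

Lemma cvg_gauss n f : (forall u, `|f u| <= 1) ->
  u ^+ n * expR (- (a * u ^+ 2)) * f u @[u --> +oo] --> (0 : R).
Proof.
move=> f1; have [k kP] := powerM_gauss_dominated n.
apply: (cvg0_dominated (k := k)) => u u0.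
rewrite normrM (le_trans (ler_piMr _ (f1 u)))// (le_trans (kP u u0))//.
have k0 : 0 <= k.
  have := le_trans (normr_ge0 _) (kP u u0).
  by rewrite pmulr_lge0// invr_gt0 ltr_pwDl ?sqr_ge0.
rewrite ler_wpM2l// lef_pV2 ?posrE ?ltr_pwDl ?sqr_ge0//.
have aux (t : R) : t <= 1 + t ^+ 2 by nra.
exact: aux.
Qed.

#[local] Instance is_derive_power n x :
  is_derive x 1 (fun u : R => u ^+ n) (n%:R * x ^+ n.-1).
Proof.
have := @is_deriveX _ _ id n x 1 1 (is_derive_id x 1).
rewrite /GRing.scale/= mulr1 (_ : id ^+ n = fun u : R => u ^+ n)//.
by apply/funext => u; rewrite exprfctE.
Qed.

(** The integrands add up to the derivative of
    u^(n+1) exp (- a u^2) cos (b u), which vanishes at both ends. *)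
Lemma gauss_ibp_cos n b :
  n.+1%:R * gauss_cos n b - 2 * a * gauss_cos n.+2 b - b * gauss_sin n.+1 b = 0.
Proof.
have i1 := integrable_gauss_cos n b; have i2 := integrable_gauss_cos n.+2 b.
have i3 := integrable_gauss_sin n.+1 b.
pose F u := u ^+ n.+1 * expR (- (a * u ^+ 2)) * cos (b * u).
pose f u := n.+1%:R * (u ^+ n * expR (- (a * u ^+ 2)) * cos (b * u)) +
  - (2 * a) * (u ^+ n.+2 * expR (- (a * u ^+ 2)) * cos (b * u)) +
  - b * (u ^+ n.+1 * expR (- (a * u ^+ 2)) * sin (b * u)).
have : \int[lam]_(u in pos) f u = 0 - F 0.
  apply: integral_derive.
  - apply: integrable_realD; last exact: integrable_realZ.
    by apply: integrable_realD; exact: integrable_realZ.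
  - apply: continuous_realD; [apply: continuous_realD|]; apply: continuous_realZ.
    + exact: (continuous_gaussM (@continuous_cosM b)).
    + exact: (continuous_gaussM (@continuous_cosM b)).
    + exact: (continuous_gaussM (@continuous_sinM b)).
  - move=> u; rewrite /F; apply: is_derive_eq; rewrite /GRing.scale/=.
    by rewrite /f !exprS; ring.
  - by apply: cvg_gauss => u; rewrite ler_norml cos_geN1 cos_le1.
rewrite /F expr0n !mul0r subr0 /f => <-.
rewrite RintegralD//; last 2 first.
- by apply: integrable_realD; exact: integrable_realZ.
- exact: integrable_realZ.
rewrite RintegralD//; try exact: integrable_realZ.
by rewrite !RintegralZl// !mulNr.
Qed.

(** The same with the derivative of u^(n+1) exp (- a u^2) sin (b u). *)
Lemma gauss_ibp_sin n b :
  n.+1%:R * gauss_sin n b - 2 * a * gauss_sin n.+2 b + b * gauss_cos n.+1 b = 0.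
Proof.
have i1 := integrable_gauss_sin n b; have i2 := integrable_gauss_sin n.+2 b.
have i3 := integrable_gauss_cos n.+1 b.
pose F u := u ^+ n.+1 * expR (- (a * u ^+ 2)) * sin (b * u).
pose f u := n.+1%:R * (u ^+ n * expR (- (a * u ^+ 2)) * sin (b * u)) +
  - (2 * a) * (u ^+ n.+2 * expR (- (a * u ^+ 2)) * sin (b * u)) +
  b * (u ^+ n.+1 * expR (- (a * u ^+ 2)) * cos (b * u)).
have : \int[lam]_(u in pos) f u = 0 - F 0.
  apply: integral_derive.
  - apply: integrable_realD; last exact: integrable_realZ.
    by apply: integrable_realD; exact: integrable_realZ.
  - apply: continuous_realD; [apply: continuous_realD|]; apply: continuous_realZ.
    + exact: (continuous_gaussM (@continuous_sinM b)).
    + exact: (continuous_gaussM (@continuous_sinM b)).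
    + exact: (continuous_gaussM (@continuous_cosM b)).
  - move=> u; rewrite /F; apply: is_derive_eq; rewrite /GRing.scale/=.
    by rewrite /f !exprS; ring.
  - by apply: cvg_gauss => u; rewrite ler_norml sin_geN1 sin_le1.
rewrite /F expr0n !mul0r subr0 /f => <-.
rewrite RintegralD//; last 2 first.
- by apply: integrable_realD; exact: integrable_realZ.
- exact: integrable_realZ.
rewrite RintegralD//; try exact: integrable_realZ.
by rewrite !RintegralZl// !mulNr.
Qed.

(** The sine makes up for the missing power of u at 0. *)
Lemma gauss_ibp_sin0 b : b * gauss_cos 0 b - 2 * a * gauss_sin 1 b = 0.
Proof.
have i1 := integrable_gauss_cos 0 b; have i2 := integrable_gauss_sin 1 b.
pose F u := u ^+ 0 * expR (- (a * u ^+ 2)) * sin (b * u).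
pose f u := b * (u ^+ 0 * expR (- (a * u ^+ 2)) * cos (b * u)) +
  - (2 * a) * (u ^+ 1 * expR (- (a * u ^+ 2)) * sin (b * u)).
have : \int[lam]_(u in pos) f u = 0 - F 0.
  apply: integral_derive.
  - by apply: integrable_realD; exact: integrable_realZ.
  - apply: continuous_realD; apply: continuous_realZ.
    + exact: (continuous_gaussM (@continuous_cosM b)).
    + exact: (continuous_gaussM (@continuous_sinM b)).
  - move=> u; rewrite /F; apply: is_derive_eq; rewrite /GRing.scale/=.
    by rewrite /f; ring.
  - by apply: cvg_gauss => u; rewrite ler_norml sin_geN1 sin_le1.
rewrite /F mulr0 sin0 mulr0 subr0 /f => <-.
rewrite RintegralD//; try exact: integrable_realZ.
by rewrite !RintegralZl// !mulNr.
Qed.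
(** The substitution u |-> u sqrt a reduces to the Gaussian integral. *)
Lemma gauss_cos00 : gauss_cos 0 0 = Num.sqrt (pi / a) / 2.
Proof.
have s0 : 0 < Num.sqrt a by rewrite sqrtr_gt0.
pose g : measurableTypeR R -> \bar R := (EFin \o gauss_fun) \_ pos.
have mg : measurable_fun setT g.
  apply: (iffLR (measurable_restrictT _ (measurable_itv _))).
  by apply/measurable_EFinP; apply: measurable_funTS; exact: measurable_gauss_fun.
have g0 x : (0 <= g x)%E.
  by rewrite /g patchE; case: ifP => // _; rewrite lee_fin gauss_fun_ge0.
have := integral_affine 0 (lt0r_neq0 s0) mg g0.
rewrite {2}/g -[X in (_ * X)%E](integral_mkcond pos) integral_itv_obnd_cbnd; last first.
  by apply/measurable_EFinP; apply: measurable_funTS; exact: measurable_gauss_fun.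
rewrite integral0y_gauss -EFinM gtr0_norm// => E.
rewrite /gauss_cos /Rintegral integral_mkcond.
rewrite (_ : integral _ _ _ = (\int[lam]_x g (Num.sqrt a * x + 0)%R)%E).
  rewrite E/= sqrtrM ?pi_ge0// sqrtrV ?(ltW a_gt0)//; ring.
apply: eq_integral => u _; rewrite /g !patchE addr0.
rewrite !mem_setE !in_itv/= !andbT pmulr_rgt0//; case: ifP => // _.
rewrite expr0 mul1r mul0r cos0 mulr1 /gauss_fun exprMn sqr_sqrtr ?(ltW a_gt0)//.
Qed.

(** Differentiation under the integral, with derivative dominated by
    u exp (- a u^2) uniformly in b. *)
Lemma is_derive_gauss_cos0 b : is_derive b 1 (gauss_cos 0) (- gauss_sin 1 b).
Proof.
pose f b u := u ^+ 0 * expR (- (a * u ^+ 2)) * cos (b * u).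
pose G u := `|u ^+ 1 * expR (- (a * u ^+ 2)) * 1|.
have df x u : is_derive x 1 (f ^~ u) (- (u ^+ 1 * expR (- (a * u ^+ 2)) * sin (x * u))).
  rewrite /f; apply: is_derive_eq; rewrite /GRing.scale/=; ring.
have bI : b \in `](b - 1), (b + 1)[ by rewrite in_itv/=; lra.
have iG : lam.-integrable pos (EFin \o G).
  have /integrable_norm : lam.-integrable pos (EFin \o (fun u => u ^+ 1 * expR (- (a * u ^+ 2)) * 1)).
    by apply: (@integrable_gauss 1 (cst 1)); [exact: cst_continuous|move=> u; rewrite normr1].
  by [].
have G0 u : 0 <= G u by exact: normr_ge0.
have GE x u : `|partial1of2 f x u| <= G u.
  rewrite partial1of2E; have [_ ->] := df x u.
  rewrite normrN /G !normrM normr1 ler_wpM2l ?mulr_ge0// ler_norml sin_geN1 sin_le1//.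
have intf x : lam.-integrable pos (EFin \o f x) by exact: integrable_gauss_cos.
have dv x u : derivable (f ^~ u) x 1 by have [] := df x u.
have D1 := @derivable_under_integral _ _ _ lam f pos (measurable_itv _) b (b - 1) (b + 1) bI
  (fun x _ => intf x) (fun x u _ _ => dv x u) G G0 iG (fun x u _ _ => GE x u).
have D2 := @differentiation_under_integral _ _ _ lam f pos (measurable_itv _) b (b - 1) (b + 1) bI
  (fun x _ => intf x) (fun x u _ _ => dv x u) G G0 iG (fun x u _ _ => GE x u).
apply: DeriveDef; first exact: D1.
rewrite -derive1E [LHS]D2 /gauss_sin -mulN1r -RintegralZl//; last exact: integrable_gauss_sin.
apply: eq_Rintegral => u _; rewrite partial1of2E mulN1r; by have [_ ->] := df b u.
Qed.

(** Integrating by parts, the derivative in b is - b / (2 a) times the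
    function: multiplied by exp (b^2 / (4 a)), it is constant. *)
Lemma gauss_cos0E b : gauss_cos 0 b = Num.sqrt (pi / a) / 2 * expR (- (b ^+ 2 / (4 * a))).
Proof.
have dJ := is_derive_gauss_cos0.
have a0 : a != 0 by rewrite gt_eqF.
pose H x := gauss_cos 0 x * expR (x ^+ 2 / (4 * a)).
have dH x : is_derive x 1 H 0.
  rewrite /H; apply: is_derive_eq; rewrite /GRing.scale/=.
  have := gauss_ibp_sin0 x => /eqP; rewrite subr_eq0 => /eqP h.
  have -> : gauss_sin 1 x = x * gauss_cos 0 x / (2 * a) by rewrite h; field.
  by field.
have := is_derive_0_is_cst b 0 dH.
rewrite /H expr0n mul0r expR0 mulr1 gauss_cos00 => <-.
by rewrite -mulrA -expRD subrr expR0 mulr1.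
Qed.
(** The recursion given by the integrations by parts, solved from the bottom
    up. *)
Lemma gauss_moments b : let J := gauss_cos 0 b in let m := (2 * a)^-1 in
  [/\ gauss_sin 1 b = m * b * J,
      gauss_cos 2 b = m * (1 - m * b ^+ 2) * J,
      gauss_sin 3 b = m ^+ 2 * b * (3 - m * b ^+ 2) * J &
      gauss_cos 4 b = m ^+ 2 * (3 - 6 * m * b ^+ 2 + m ^+ 2 * b ^+ 4) * J].
Proof.
move=> J m.
have a0 : a != 0 by rewrite gt_eqF.
have solve (p q : R) : p - 2 * a * q = 0 -> q = m * p.
  by move/eqP; rewrite subr_eq0 => /eqP ->; rewrite /m; field.
have s1 : gauss_sin 1 b = m * b * J by rewrite (solve _ _ (gauss_ibp_sin0 b)) mulrA.
have c2 : gauss_cos 2 b = m * (1 - m * b ^+ 2) * J.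
  have := gauss_ibp_cos 0 b; rewrite mul1r addrAC => /solve ->.
  by rewrite s1 -/J; ring.
have s3 : gauss_sin 3 b = m ^+ 2 * b * (3 - m * b ^+ 2) * J.
  have := gauss_ibp_sin 1 b; rewrite addrAC => /solve ->.
  by rewrite s1 c2; ring.
split => //.
have := gauss_ibp_cos 2 b; rewrite addrAC => /solve ->.
by rewrite c2 s3; ring.
Qed.

Lemma gauss_cos_even_moments : let J := gauss_cos 0 0 in let m := (2 * a)^-1 in
  gauss_cos 6 0 = 15 * m ^+ 3 * J /\ gauss_cos 8 0 = 105 * m ^+ 4 * J.
Proof.
move=> J m; have a0 : a != 0 by rewrite gt_eqF.
have solve (p q : R) : p - 2 * a * q = 0 -> q = m * p.
  by move/eqP; rewrite subr_eq0 => /eqP ->; rewrite /m; field.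
have [_ _ _ c4] := gauss_moments 0.
have c6 : gauss_cos 6 0 = 15 * m ^+ 3 * J.
  have := gauss_ibp_cos 4 0; rewrite mul0r subr0 => /solve ->.
  by rewrite c4 -/m -/J; ring.
split => //; have := gauss_ibp_cos 6 0; rewrite mul0r subr0 => /solve ->.
by rewrite c6; ring.
Qed.

End Gaussian.

Section EdgeworthTransform.
Context {R : realType}.
Notation lam := (@lebesgue_measure R).
Notation pos := (`]0%R, +oo[%classic : set (measurableTypeR R)).
Variable d : nat.
Hypothesis d_gt0 : (0 < d)%N.
Let D : R := d%:R.
Let D_gt0 : 0 < D. Proof. by rewrite ltr0n. Qed.
Let a : R := D / 6.
Let a_gt0 : 0 < a. Proof. by rewrite divr_gt0. Qed.

Lemma edgeworthE (u : R) : edgeworth d u =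
  u ^+ 0 * expR (- (a * u ^+ 2)) * 1 - D / 180 * (u ^+ 4 * expR (- (a * u ^+ 2)) * 1).
Proof.
rewrite /edgeworth -/D (_ : D * u ^+ 2 / 6 = a * u ^+ 2); last by rewrite /a; field.
by move: (180^-1) => k; ring.
Qed.

Lemma edgeworth_cosE (b u : R) : edgeworth d u * cos (b * u) =
  u ^+ 0 * expR (- (a * u ^+ 2)) * cos (b * u) +
  - (D / 180) * (u ^+ 4 * expR (- (a * u ^+ 2)) * cos (b * u)).
Proof. by rewrite edgeworthE; ring. Qed.

Lemma integrable_edgeworth_cos b :
  lam.-integrable pos (EFin \o (fun u => edgeworth d u * cos (b * u))).
Proof.
rewrite (funext (edgeworth_cosE b)).
apply: integrable_realD; last apply: integrable_realZ; exact: integrable_gauss_cos.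
Qed.

(** With a = d/6 and b = 2 t sqrt d the moments of order 0 and 4 give the
    main term and its correction, since b^2 / (4 a) = 6 t^2 and
    (d/180) (3/d)^2 3 = 3 / (20 d). *)
Lemma integral_edgeworth_cos (t : R) :
  2 * Num.sqrt D / pi * (\int[lam]_(u in pos) (edgeworth d u * cos (2 * (Num.sqrt D * t) * u))) =
  Num.sqrt (6 / pi) * expR (- 6 * t ^+ 2) *
   (1 - (3 - 72 * t ^+ 2 + 144 * t ^+ 4) / (20 * D)).
Proof.
set s := Num.sqrt D; have s0 : 0 < s by rewrite sqrtr_gt0.
have sD : s ^+ 2 = D by rewrite sqr_sqrtr ?ltW.
set b := 2 * (s * t).
have pi0 := @pi_gt0 R.
rewrite (funext (edgeworth_cosE b)).
rewrite RintegralD//; last 2 first.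
- exact: integrable_gauss_cos.
- by apply: integrable_realZ; exact: integrable_gauss_cos.
rewrite RintegralZl//; last exact: integrable_gauss_cos.
rewrite -!/(gauss_cos _ _ _).
have [_ _ _ ->] := gauss_moments a_gt0 b.
rewrite gauss_cos0E//.
have -> : b ^+ 2 / (4 * a) = 6 * t ^+ 2.
  by rewrite /b /a -sD; field; rewrite gt_eqF.
have -> : b ^+ 2 = 4 * D * t ^+ 2 by rewrite /b -sD; ring.
have -> : b ^+ 4 = 16 * D ^+ 2 * t ^+ 4 by rewrite /b -sD; ring.
have sqrt_pia : Num.sqrt (pi / a) = pi / s * Num.sqrt (6 / pi).
  rewrite -[pi / s]gtr0_norm ?divr_gt0// -sqrtr_sqr -sqrtrM ?sqr_ge0//.
  congr Num.sqrt; rewrite expr_div_n sD /a; move: pi0 D_gt0; move: (@pi R) D => p q p0 q0.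
  by field; rewrite !gt_eqF.
rewrite sqrt_pia -mulNr; move: (expR _) (Num.sqrt (6 / pi)) => e r.
suff aux (p q q' : R) : 0 < p -> 0 < q -> 0 < q' ->
    2 * q / p * (p / q * r / 2 * e - q' / 180 *
      ((2 * (q' / 6))^-1 ^+ 2 * (3 - 6 / (2 * (q' / 6)) * (4 * q' * t ^+ 2) +
       (2 * (q' / 6))^-1 ^+ 2 * (16 * q' ^+ 2 * t ^+ 4)) * (p / q * r / 2 * e))) =
    r * e * (1 - (3 - 72 * t ^+ 2 + 144 * t ^+ 4) / (20 * q')).
  by rewrite mulNr; exact: (aux pi s D pi0 s0 D_gt0).
by move=> p0 q0 q'0; field; rewrite !gt_eqF.
Qed.
End EdgeworthTransform.

(** * Integrating the error *)

(** By induction from d = 136: there (17/20)^5 < 1/2 bounds the power by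
    2^-26, and (1 + 1/d)^2 (17/20) < 1 afterwards. *)
Lemma sqrM_geometric_small {R : realType} d : (136 <= d)%N ->
  (d%:R ^+ 2 * (17 / 20) ^+ (d - 2) : R) <= 1 / 100.
Proof.
move=> hd; rewrite -(subnK hd); elim: (d - 136)%N => [|n IH].
  rewrite add0n (_ : (136 - 2 = 5 * (7 + 7 + 10 + 2) + 4)%N)// exprD exprM.
  have q5 : ((17 / 20) ^+ 5 : R) <= 1 / 2 by rewrite !exprS expr0; lra.
  have q0 : 0 <= (17 / 20 : R) by lra.
  have h1 : ((17 / 20) ^+ 5) ^+ (7 + 7 + 10 + 2) <= (1 / 2) ^+ (7 + 7 + 10 + 2) :> R.
    by rewrite lerXn2r ?nnegrE ?exprn_ge0//; lra.
  have h2 : ((17 / 20) ^+ 4 : R) <= 1 by rewrite exprn_ile1//; lra.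
  have h3 : ((1 / 2) ^+ (7 + 7 + 10 + 2) : R) <= (1 / 100) * (1 / 100) * (1 / 1000).
    rewrite !exprD.
    have a7 : ((1 / 2) ^+ 7 : R) <= 1 / 100 by rewrite !exprS expr0; lra.
    have a10 : ((1 / 2) ^+ 10 : R) <= 1 / 1000 by rewrite !exprS expr0; lra.
    have a2 : ((1 / 2) ^+ 2 : R) <= 1 by rewrite !exprS expr0; lra.
    have p m : 0 <= (1 / 2) ^+ m :> R by rewrite exprn_ge0.
    have b1 := ler_pM (p 7%N) (p 7%N) a7 a7.
    have b2 := ler_pM (mulr_ge0 (p 7%N) (p 7%N)) (p 10%N) b1 a10.
    by have := ler_pM (mulr_ge0 (mulr_ge0 (p 7%N) (p 7%N)) (p 10%N)) (p 2%N) b2 a2; rewrite mulr1.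
  have h4 : ((17 / 20) ^+ 5) ^+ (7 + 7 + 10 + 2) * (17 / 20) ^+ 4 <=
      (1 / 100) * (1 / 100) * (1 / 1000) * 1 :> R.
    by apply: ler_pM (le_trans h1 h3) h2; rewrite ?exprn_ge0.
  apply: le_trans (ler_wpM2l (sqr_ge0 _) h4) _.
  by rewrite expr2; lra.
rewrite addSn subSn; last by lia.
rewrite (exprS _ (n + 136 - 2)).
have n1 : 136 <= (n + 136)%:R :> R by rewrite ler_nat leq_addl.
rewrite -[(n + 136).+1]addn1 natrD.
have e0 : 0 <= ((17 / 20) ^+ (n + 136 - 2) : R) by rewrite exprn_ge0//; lra.
move: IH n1 e0; move: ((n + 136)%:R : R) (_ ^+ (n + 136 - 2)) => x q IH n1 e0.
have h : (x + 1) ^+ 2 * (17 / 20) <= x ^+ 2 by nra.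
by rewrite mulrA; apply: le_trans IH; rewrite ler_wpM2r.
Qed.

Section ErrorIntegral.
Context {R : realType}.
Notation lam := (@lebesgue_measure R).
Notation pos := (`]0%R, +oo[%classic : set (measurableTypeR R)).
Variable d : nat.
Hypothesis d_ge136 : (136 <= d)%N.
Let D : R := d%:R.
Let d_gt0 : (0 < d)%N. Proof. exact: leq_trans d_ge136. Qed.
Let D_gt0 : 0 < D. Proof. by rewrite ltr0n. Qed.
Let a : R := D / 6.
Let a_gt0 : 0 < a. Proof. by rewrite divr_gt0. Qed.
Let q : R := (17 / 20) ^+ (d - 2).

Lemma edgeworth_errorE (u : R) : edgeworth_error d u =
  D / 75 * (u ^+ 6 * expR (- (a * u ^+ 2)) * cos (0 * u)) +
  (D / 180) ^+ 2 / 2 * (u ^+ 8 * expR (- (a * u ^+ 2)) * cos (0 * u)) +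
  q * 2 / (1 + u ^+ 2).
Proof.
rewrite /edgeworth_error -/D -/q mul0r cos0 (_ : D * u ^+ 2 / 6 = a * u ^+ 2); last first.
  by rewrite /a; field.
by congr (_ + _); move: (180^-1) (75^-1) => k k'; field.
Qed.

Lemma integrable_edgeworth_error : lam.-integrable pos (EFin \o (@edgeworth_error R d)).
Proof.
rewrite (funext edgeworth_errorE).
apply: integrable_realD; last exact: integrable_inv_1Dsqr.
by apply: integrable_realD; apply: integrable_realZ; exact: integrable_gauss_cos.
Qed.

(** The Gaussian moments of order 6 and 8 contribute 15 * 27 / 75 = 27/5 and
    105 * 81 / (2 * 180^2) = 21/160. *)
Lemma integral_edgeworth_error :
  2 * Num.sqrt D / pi * \int[lam]_(u in pos) edgeworth_error d u =
  Num.sqrt (6 / pi) * (27 / 5 + 21 / 160) / D ^+ 2 + 2 * Num.sqrt D * q.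
Proof.
set s := Num.sqrt D; have s0 : 0 < s by rewrite sqrtr_gt0.
have sD : s ^+ 2 = D by rewrite sqr_sqrtr ?ltW.
have pi0 := @pi_gt0 R.
rewrite (funext edgeworth_errorE).
have i6 := integrable_gauss_cos a_gt0 6 0.
have i8 := integrable_gauss_cos a_gt0 8 0.
rewrite RintegralD//; last 2 first.
- by apply: integrable_realD; exact: integrable_realZ.
- exact: integrable_inv_1Dsqr.
rewrite RintegralD//; try exact: integrable_realZ.
have i1 : lam.-integrable pos (EFin \o (fun u : R => (1 + u ^+ 2)^-1)).
  by have := integrable_inv_1Dsqr (1 : R); congr (integrable _ _ _); apply/funext => u; rewrite div1r.
rewrite !RintegralZl// -!/(gauss_cos _ _ _).
rewrite [\int[_]_(_ in _) (_ + _)^-1]/Rintegral integral_inv_1Dsqr/=.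
have [-> ->] := gauss_cos_even_moments a_gt0.
rewrite gauss_cos00//.
have sqrt_pia : Num.sqrt (pi / a) = pi / s * Num.sqrt (6 / pi).
  rewrite -[pi / s]gtr0_norm ?divr_gt0// -sqrtr_sqr -sqrtrM ?sqr_ge0//.
  congr Num.sqrt; rewrite expr_div_n sD /a; move: pi0 D_gt0; move: (@pi R) D => p x p0 x0.
  by field; rewrite !gt_eqF.
rewrite sqrt_pia; move: (Num.sqrt (6 / pi)) => r.
suff aux (p x y : R) : 0 < p -> 0 < x -> 0 < y ->
    2 * x / p * (y / 75 * (15 * (2 * (y / 6))^-1 ^+ 3 * (p / x * r / 2)) +
      (y / 180) ^+ 2 / 2 * (105 * (2 * (y / 6))^-1 ^+ 4 * (p / x * r / 2)) +
      q * 2 * (p / 2)) =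
    r * (27 / 5 + 21 / 160) / y ^+ 2 + 2 * x * q.
  exact: (aux pi s D pi0 s0 D_gt0).
by move=> p0 x0 y0; field; rewrite !gt_eqF.
Qed.

(** As pi >= 2, sqrt (6 / pi) <= 7/4, so that the first term is less than
    10 / d^2, to be compared with sqrt d / d^2 > 11 / d^2. *)
Lemma edgeworth_error_small :
  2 * Num.sqrt D / pi * \int[lam]_(u in pos) edgeworth_error d u <
  1 / (D `^ (3 / 2)).
Proof.
have pi2 := @pi_ge2 R; have pi0 := @pi_gt0 R.
rewrite integral_edgeworth_error.
set s := Num.sqrt D; have s0 : 0 < s by rewrite sqrtr_gt0.
have sD : s ^+ 2 = D by rewrite sqr_sqrtr ?ltW.
have D136 : 136 <= D by rewrite ler_nat.
have -> : D `^ (3 / 2) = D * s.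
  rewrite (_ : 3 / 2 = 1 + 2^-1); last by field.
  by rewrite powRD ?powRr1 ?powR12_sqrt ?ltW// gt_eqF.
have qs := @sqrM_geometric_small R d d_ge136; rewrite -/D -/q in qs.
have s11 : 11 < s.
  rewrite -(@ltr_pXn2r _ 2) ?nnegrE ?ltW// sD; lra.
set r := Num.sqrt (6 / pi).
have r2 : r <= 7 / 4.
  rewrite /r -[leRHS]gtr0_norm; last by lra.
  rewrite -sqrtr_sqr ler_wsqrtr// ler_pdivrMr//; lra.
have r0 : 0 <= r by exact: sqrtr_ge0.
have D20 : 0 < D ^+ 2 by rewrite exprn_gt0.
have -> : 1 / (D * s) = s / D ^+ 2.
  by rewrite -sD; field; rewrite gt_eqF.
have -> : 2 * s * q = (2 * s * (D ^+ 2 * q)) / D ^+ 2 by field; rewrite gt_eqF.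
rewrite -mulrDl ltr_pM2r ?invr_gt0//.
have h1 : 2 * s * (D ^+ 2 * q) <= 2 * s * (1 / 100) by rewrite ler_wpM2l// mulr_ge0// ltW.
lra.
Qed.

Theorem sinc_integral_edgeworth (t : R) :
  `| 2 * Num.sqrt D / pi * \int[lam]_(u in pos) (sinc u ^+ d * cos (2 * (Num.sqrt D * t) * u))
     - Num.sqrt (6 / pi) * expR (- 6 * t ^+ 2)
       * (1 - (3 - 72 * t ^+ 2 + 144 * t ^+ 4) / (20 * D)) |
  < 1 / (D `^ (3 / 2)).
Proof.
rewrite -integral_edgeworth_cos// -/D -mulrBr.
set b := 2 * (Num.sqrt D * t).
have i1 : lam.-integrable pos (EFin \o (fun u => sinc u ^+ d * cos (b * u))).
  by rewrite -(subnK (leq_trans (isT : (2 <= 136)%N) d_ge136)) addn2; exact: integrable_sinc_cos.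
have i2 := integrable_edgeworth_cos d_gt0 b.
apply: le_lt_trans edgeworth_error_small.
rewrite -RintegralB// normrM ger0_norm; last first.
  by rewrite divr_ge0 ?mulr_ge0 ?sqrtr_ge0 ?pi_ge0.
apply: ler_wpM2l; first by rewrite divr_ge0 ?mulr_ge0 ?sqrtr_ge0 ?pi_ge0.
have i3 : lam.-integrable pos (EFin \o (fun u => sinc u ^+ d * cos (b * u) - edgeworth d u * cos (b * u))).
  by have := @integrableB _ _ _ lam _ (measurable_itv _) _ _ i1 i2.
apply: le_trans (le_normr_Rintegral _ i3) _ => //.
apply: le_Rintegral => //.
- by have /integrable_norm := i3.
- exact: integrable_edgeworth_error.
move=> u /=; rewrite in_itv/= andbT => u0.
rewrite -mulrBl normrM (le_trans (ler_piMr _ (_ : _ <= 1)))//.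
  by rewrite ler_norml cos_geN1 cos_le1.
exact: sinc_expn_edgeworth.
Qed.
End ErrorIntegral.

(** * Hyperplanes orthogonal to a diagonal *)

Section Geometry.
Context {R : realType}.
Notation mR := (measurableTypeR R).

Lemma dotE n (x y : 'rV[R]_n) : dot x y = (x *m y^T) 0 0.
Proof. by rewrite mxE; apply: eq_bigr => i _; rewrite mxE. Qed.

Lemma dotDr n (x y z : 'rV[R]_n) : dot x (y + z) = dot x y + dot x z.
Proof. by rewrite !dotE linearD mulmxDr mxE. Qed.

Lemma dotZr n k (x y : 'rV[R]_n) : dot x (k *: y) = k * dot x y.
Proof. by rewrite !dotE linearZ -scalemxAr mxE. Qed.

Lemma dotC n (x y : 'rV[R]_n) : dot x y = dot y x.
Proof. by apply: eq_bigr => i _; rewrite mulrC. Qed.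

Lemma dotBr n (x y z : 'rV[R]_n) : dot x (y - z) = dot x y - dot x z.
Proof. by rewrite -scaleN1r dotDr dotZr mulN1r. Qed.

(** Expanded so that a suitable k gives the Cauchy-Schwarz inequality. *)
Lemma dot_subZ n k (z e : 'rV[R]_n) :
  dot (z - k *: e) (z - k *: e) = dot z z - 2 * k * dot e z + k ^+ 2 * dot e e.
Proof.
rewrite dotBr dotZr (dotC (_ - _) z) (dotC (_ - _) e) !dotBr !dotZr (dotC z e).
by ring.
Qed.

Lemma dot_ge0 n (x : 'rV[R]_n) : 0 <= dot x x.
Proof. by apply: sumr_ge0 => i _; rewrite -expr2 sqr_ge0. Qed.

(** The difference of two opposite vertices has this form. *)
Definition sign_vector n (e : 'rV[R]_n) := forall i, e 0 i ^+ 2 = 1.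

Lemma opposite_vertices_sign n (v w : 'rV[R]_n) :
  opposite_vertices v w -> sign_vector (w - v).
Proof.
move=> [hv hw vw] i; rewrite !mxE; have := vw i.
by case: (hv i) => ->; case: (hw i) => -> // _; ring.
Qed.

Lemma dot_sign n (e : 'rV[R]_n) : sign_vector e -> dot e e = n%:R.
Proof.
move=> he; rewrite /dot (eq_bigr (fun=> 1)) => [|i _]; last by rewrite -expr2 he.
by rewrite sumr_const card_ord.
Qed.

(** Cauchy-Schwarz gives the lower bound, and it is reached at the foot
    of the perpendicular from c. *)
Lemma euclidean_dist_hyperplane n (e c : 'rV[R]_n.+1) b : sign_vector e ->
  euclidean_dist c [set x | dot e x = b] = `|b - dot e c| / Num.sqrt n.+1%:R.
Proof.
move=> he; set D := n.+1%:R : R; have D0 : 0 < D by rewrite ltr0n.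
have ee : dot e e = D by exact: dot_sign.
set s := b - dot e c; set r := Num.sqrt D; have r0 : 0 < r by rewrite sqrtr_gt0.
have rD : r ^+ 2 = D by rewrite sqr_sqrtr ?ltW.
rewrite /euclidean_dist; set A := image _ _.
have lbA : lbound A (`|s| / r).
  move=> _ [y /= ey <-]; rewrite /euclidean_norm.
  rewrite -[leLHS]ger0_norm ?divr_ge0 ?(ltW r0)// -sqrtr_sqr ler_wsqrtr//.
  rewrite expr_div_n real_normK ?num_real// rD.
  have ez : dot e (c - y) = - s by rewrite dotBr ey /s opprB.
  move: ez; set z := c - y => ez.
  have := dot_ge0 (z - (- s / D) *: e).
  rewrite dot_subZ ez ee => h.
  rewrite -subr_ge0; apply: le_trans h _; rewrite le_eqVlt; apply/orP; left; apply/eqP.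
  by field; rewrite gt_eqF.
have inA : A (`|s| / r).
  exists (c + (s / D) *: e).
    by rewrite /= dotDr dotZr ee /s divfK ?gt_eqF//; ring.
  rewrite /euclidean_norm opprD addrA subrr sub0r -scaleN1r scalerA.
  rewrite dotZr dotC dotZr ee mulN1r -[RHS]ger0_norm ?divr_ge0 ?(ltW r0)// -sqrtr_sqr.
  congr Num.sqrt; rewrite expr_div_n real_normK ?num_real// rD.
  by field; rewrite gt_eqF.
apply/eqP; rewrite eq_le; apply/andP; split.
  by apply: ge_inf => //; exists (`|s| / r).
by apply: lb_le_inf => //; exists (`|s| / r).
Qed.

Lemma chart_orthogonal m (e p : 'rV[R]_m.+1) (Q : 'M[R]_(m, m.+1)) b :
  isometric_chart [set x | dot e x = b] p Q -> dot e p = b /\ e *m Q^T = 0.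
Proof.
move=> [QQ rg].
have inH y : dot e (affine_map p Q y) = b.
  have : range (affine_map p Q) (affine_map p Q y) by exists y.
  by rewrite rg.
have ep : dot e p = b.
  rewrite -(inH [tuple 0 | i < m]) /affine_map.
  rewrite (_ : \row_i _ = 0) ?mul0mx ?addr0//.
  by apply/rowP => i; rewrite !mxE tnth_mktuple.
split => //; apply/rowP => i; rewrite [RHS]mxE.
have := inH [tuple (i == j)%:R | j < m]; rewrite /affine_map dotDr ep.
rewrite (_ : \row_j _ = delta_mx 0 i); last first.
  by apply/rowP => j; rewrite !mxE tnth_mktuple eq_sym.
rewrite -rowE => /eqP; rewrite -subr_eq0 addrAC subrr add0r => /eqP <-.
by rewrite mxE; apply: eq_bigr => j _; rewrite !mxE.
Qed.
(** For an orthogonal matrix the adjugate is plus or minus the transpose, so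
    that a minor is the complementary entry up to sign. *)
Lemma orthonormal_frame_minor m (h : 'rV[R]_m.+1) (Q : 'M[R]_(m, m.+1)) :
  Q *m Q^T = 1%:M -> h *m Q^T = 0 -> dot h h = 1 ->
  `|\det (col' ord0 Q)| = `|h 0 ord0|.
Proof.
move=> QQ hQ hh.
pose O : 'M[R]_m.+1 := col_mx h Q : 'M[R]_(1 + m, m.+1).
have OO : O *m O^T = 1%:M.
  transitivity (block_mx (h *m h^T) (h *m Q^T) (Q *m h^T) (Q *m Q^T) : 'M[R]_(1 + m)).
    by rewrite -mul_col_row -tr_col_mx.
  have Qh : Q *m h^T = 0 by rewrite -[LHS]trmxK trmx_mul trmxK hQ trmx0.
  have hh1 : h *m h^T = 1%:M.
    by apply/matrixP => i j; rewrite !ord1 -dotE hh mxE eqxx.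
  by rewrite hQ Qh QQ hh1 -scalar_mx_block.
have detO : \det O ^+ 2 = 1.
  by have := congr1 (fun A => \det A) OO; rewrite /= det_mulmx det_tr det1 -expr2.
have adjO : \adj O = \det O *: O^T.
  have := mulmx1C OO => OO'.
  by rewrite -[LHS]mul1mx -OO' -mulmxA mul_mx_adj mul_mx_scalar.
have minorE : \det (col' ord0 Q) = \adj O ord0 ord0.
  rewrite mxE /cofactor addn0 expr0 mul1r; congr (\det _).
  apply/matrixP => i j; rewrite !mxE; case: splitP => k /=; first by rewrite ord1.
  by move=> [] ik; congr (Q _ _); exact: val_inj.
have O00 : O ord0 ord0 = h 0 ord0.
  rewrite mxE; case: splitP => k //= _; by rewrite ord1.
rewrite minorE adjO !mxE normrM.
have -> : `|\det O| = 1.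
  by apply/eqP; rewrite -(@eqrXn2 _ 2)// ?expr1n ?real_normK ?num_real ?detO.
rewrite mul1r; case: splitP => k //= _; by rewrite ord1.
Qed.

(** In the coordinates z_i = e_i (x_i - 1/2) with i <> 0, the chart is an
    affine map whose linear part has determinant 1 / sqrt d in absolute value,
    and the section becomes [cube_slab]. *)
Lemma chart_volume m (e p : 'rV[R]_m.+1) (Q : 'M[R]_(m, m.+1)) b : sign_vector e ->
  isometric_chart [set x | dot e x = b] p Q ->
  lebesgue_tuple (affine_map p Q @^-1` ([set x | dot e x = b] `&` @hypercube R m.+1)) =
  ((Num.sqrt m.+1%:R)%:E * lebesgue_tuple (@cube_slab R m (b - dot e (hypercube_center m.+1))))%E.
Proof.
move=> he ch; have [ep eQ] := chart_orthogonal ch; have [QQ rg] := ch.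
set D : R := m.+1%:R; have D0 : 0 < D by rewrite ltr0n.
set r := Num.sqrt D; have r0 : 0 < r by rewrite sqrtr_gt0.
have rD : r ^+ 2 = D by rewrite sqr_sqrtr ?ltW.
have ee : dot e e = D by exact: dot_sign.
have e1 i : `|e 0 i| = 1.
  by apply/eqP; rewrite -(@eqrXn2 _ 2)// ?expr1n ?real_normK ?num_real ?he//.
pose eps : 'rV[R]_m := \row_j e 0 (lift ord0 j).
pose M : 'M[R]_m := col' ord0 Q *m diag_mx eps.
pose c' : 'rV[R]_m := \row_j (e 0 (lift ord0 j) * (p 0 (lift ord0 j) - 1 / 2)).
have dM : `|\det M| = r^-1.
  rewrite det_mulmx det_diag normrM (@orthonormal_frame_minor _ (r^-1 *: e))//.
  - rewrite mxE normrM e1 mulr1 normfV (gtr0_norm r0) normr_prod big1 ?mulr1// => j _.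
    by rewrite mxE e1.
  - by rewrite -scalemxAl eQ scaler0.
  - by rewrite dotZr dotC dotZr ee -rD; field; rewrite gt_eqF.
have zE y j : tnth (tuple_affine M c' y) j =
    e 0 (lift ord0 j) * (affine_map p Q y 0 (lift ord0 j) - 1 / 2).
  rewrite tnth_mktuple /M mulmxA mul_mx_diag /affine_map [LHS]mxE ![in LHS]mxE [in RHS]mxE mulrC.
  rewrite -mulrDr; congr (_ * _); rewrite addrA; congr (_ - _); rewrite addrC; congr (_ + _).
  rewrite [RHS]mxE.
  by apply: eq_bigr => l _; rewrite !mxE.
have x0E y : e 0 ord0 * (affine_map p Q y 0 ord0 - 1 / 2) =
    b - dot e (hypercube_center m.+1) - \sum_j tnth (tuple_affine M c' y) j.
  have ey : dot e (affine_map p Q y) = b.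
    have : range (affine_map p Q) (affine_map p Q y) by exists y.
    by rewrite rg.
  rewrite -ey -dotBr /dot big_ord_recl.
  rewrite (eq_bigr (fun j => e 0 (lift ord0 j) *
    (affine_map p Q y - hypercube_center m.+1) 0 (lift ord0 j)) (F1 := fun j => tnth _ j)).
    by rewrite addrK !mxE.
  by move=> j _; rewrite zE !mxE.
have cubeE (x t : R) : `|t| = 1 -> (0 <= x <= 1) = (`|t * (x - 1 / 2)| <= 1 / 2).
  by move=> t1; rewrite normrM t1 !mul1r ler_norml; apply/idP/idP => /andP[]; lra.
rewrite (_ : _ @^-1` _ = tuple_affine M c' @^-1` cube_slab (b - dot e (hypercube_center m.+1))).
  rewrite scales_volume_unit.
  - by rewrite dM invrK.
  - by rewrite -normr_gt0 dM invr_gt0.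
  - exact: measurable_cube_slab.
apply/seteqP; split => y /=.
  move=> [_ cy]; split; last first.
    by rewrite -x0E -cubeE//; exact: cy.
  by move=> j; rewrite zE -cubeE//; exact: cy.
move=> [zy sy]; split.
  have : range (affine_map p Q) (affine_map p Q y) by exists y.
  by rewrite rg.
move=> i; have [j ->|->] := unliftP ord0 i.
  by rewrite (cubeE _ (e 0 (lift ord0 j)))// -zE.
by rewrite (cubeE _ (e 0 ord0))// x0E.
Qed.
(** The rows below the first of the Householder reflection exchanging h
    and the first basis vector. *)
Lemma orthonormal_completion m (h : 'rV[R]_m.+1) : dot h h = 1 -> h 0 ord0 != 1 ->
  exists Q : 'M[R]_(m, m.+1),
    [/\ Q *m Q^T = 1%:M, h *m Q^T = 0 & Q^T *m Q = 1%:M - h^T *m h].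
Proof.
move=> hh h1.
pose E : 'rV[R]_m.+1 := delta_mx 0 ord0.
pose u := h - E; pose k := (1 - h 0 ord0)^-1.
(* k is 2 / |u|^2, so that P is the reflection exchanging E and h. *)
have k0 : 1 - h 0 ord0 != 0 by rewrite subr_eq0 eq_sym.
have hE : dot h E = h 0 ord0.
  rewrite /dot (bigD1 ord0)//= mxE eqxx mulr1 big1 ?addr0// => i i0.
  by rewrite mxE (negbTE i0) mulr0.
have EE : dot E E = 1.
  rewrite /dot (bigD1 ord0)//= !mxE eqxx mulr1 big1 ?addr0// => i i0.
  by rewrite !mxE (negbTE i0) mulr0.
have uu : u *m u^T = (2 / k)%:M.
  apply/matrixP => i j; rewrite !ord1 -dotE mxE eqxx mulr1n /k invrK.
  have -> : u = h - 1 *: E by rewrite scale1r.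
  by rewrite dot_subZ hh EE dotC hE; ring.
pose P : 'M[R]_m.+1 := 1%:M - k *: (u^T *m u).
have PT : P^T = P by rewrite /P linearB linearZ/= trmx_mul trmxK trmx1.
have PP : P *m P = 1%:M.
  have WW : u^T *m u *m (u^T *m u) = (2 / k) *: (u^T *m u).
    by rewrite mulmxA -(mulmxA _ u) uu mul_mx_scalar -scalemxAl.
  rewrite /P; move: WW; move: (u^T *m u) => W WW.
  rewrite mulmxBl !mulmxBr !mulmx1 !mul1mx -scalemxAl -scalemxAr scalerA WW scalerA.
  rewrite (_ : k * k * (2 / k) = k + k); last by rewrite /k; field.
  by rewrite scalerDl opprB addrK subrK.
have P0 : row ord0 P = h.
  rewrite /P linearB/= row1 -/E linearZ/= row_mul.
  rewrite (_ : row ord0 u^T = (h 0 ord0 - 1)%:M); last first.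
    by apply/matrixP => i j; rewrite !ord1 !mxE !eqxx.
  rewrite mul_scalar_mx scalerA (_ : k * _ = -1); last by rewrite /k; field.
  rewrite scaleN1r opprK /u.
  by rewrite addrCA subrr addr0.
pose P' : 'M[R]_(1 + m, m.+1) := P.
have hP : usubmx P' = h.
  rewrite -P0; apply/matrixP => i j; rewrite [LHS]mxE [RHS]mxE ord1 /P'.
  by congr (fun_of_matrix P _ _); exact: val_inj.
pose Q := dsubmx P'.
have PE : P' = col_mx h Q by rewrite -hP vsubmxK.
exists Q.
have E1 : block_mx (h *m h^T) (h *m Q^T) (Q *m h^T) (Q *m Q^T) = 1%:M :> 'M[R]_(1 + m).
  by rewrite -mul_col_row -tr_col_mx -PE -[LHS]/(P *m P^T) PT PP.
rewrite scalar_mx_block in E1; have [_ hQ _ QQ] := eq_block_mx E1.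
split => //.
have : h^T *m h + Q^T *m Q = 1%:M.
  by rewrite -mul_row_col -tr_col_mx -PE -[LHS]/(P^T *m P) PT PP.
by move=> <-; rewrite addrAC subrr add0r.
Qed.

Lemma hyperplane_chart m (e p : 'rV[R]_m.+1) : (0 < m)%N -> sign_vector e ->
  exists Q : 'M[R]_(m, m.+1), isometric_chart [set x | dot e x = dot e p] p Q.
Proof.
move=> m0 he; set D : R := m.+1%:R; have D1 : 1 < D by rewrite ltr1n.
have D0 : 0 < D by exact: lt_trans D1.
set r := Num.sqrt D; have r0 : 0 < r by rewrite sqrtr_gt0.
have rD : r ^+ 2 = D by rewrite sqr_sqrtr ?ltW.
have ee : dot e e = D by exact: dot_sign.
have [||Q [QQ hQ QTQ]] := @orthonormal_completion m (r^-1 *: e).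
- by rewrite dotZr dotC dotZr ee -rD; field; rewrite gt_eqF.
- apply/eqP => h; have := he ord0; move: h; rewrite mxE => h.
  have -> : e 0 ord0 = r by rewrite -[RHS]mulr1 -h mulrA mulfV ?gt_eqF// mul1r.
  by rewrite rD => /eqP; rewrite gt_eqF.
have eQ : e *m Q^T = 0.
  by move: hQ; rewrite -scalemxAl => /eqP; rewrite scaler_eq0 invr_eq0 gt_eqF//= => /eqP.
exists Q; split => //; apply/seteqP; split => x /=.
  move=> [y _ <-]; rewrite /affine_map dotDr [X in _ + X]dotE trmx_mul mulmxA eQ.
  by rewrite mul0mx mxE addr0.
move=> ex; exists [tuple ((x - p) *m Q^T) 0 i | i < m] => //.
rewrite /affine_map (_ : \row_i _ = (x - p) *m Q^T); last first.
  by apply/rowP => i; rewrite mxE tnth_mktuple.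
rewrite -mulmxA QTQ mulmxBr mulmx1 mulmxA (_ : (x - p) *m _ = 0); last first.
  apply/rowP => i; rewrite !ord1 -dotE dotZr dotC dotBr ex subrr mulr0 mxE.
  by [].
by rewrite mul0mx subr0 addrCA subrr addr0.
Qed.
End Geometry.

(** * The volume of a section *)

Section SectionVolume.
Context {R : realType}.
Notation lam := (@lebesgue_measure R).
Notation pos := (`]0%R, +oo[%classic : set (measurableTypeR R)).

Lemma cube_slab_fourier k (s : R) : (0 < k)%N -> lebesgue_tuple (@cube_slab R k s) =
  (2 / pi * \int[lam]_(u in pos) (sinc u ^+ k.+1 * cos (2 * s * u)))%:E.
Proof.
case: k => // k _; elim: k s => [|k IH] s.
  rewrite lebesgue_cube_slab1 integral_sinc2_cos mulrA; congr EFin.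
  by rewrite (_ : 2 / pi * (pi / 2) = 1) ?mul1r//; move: (@pi_gt0 R); move: pi => p p0; field; rewrite gt_eqF.
rewrite lebesgue_cube_slabS; under eq_integral do rewrite IH.
exact: fourier_convolution.
Qed.

(** Every admissible hyperplane and chart give the same value, by
    [chart_volume] and because the cosine is even; the diagonal from 0 to
    (1, ..., 1) shows that there is one. *)
Lemma hypercube_section_volumeE m (t : R) : (1 < m)%N -> 0 <= t ->
  hypercube_section_volume m.+1 t = 2 * Num.sqrt m.+1%:R / pi *
    \int[lam]_(u in pos) (sinc u ^+ m.+1 * cos (2 * (Num.sqrt m.+1%:R * t) * u)).
Proof.
move=> m1 t0; set D : R := m.+1%:R; have D0 : 0 < D by rewrite ltr0n.
set r := Num.sqrt D; have r0 : 0 < r by rewrite sqrtr_gt0.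
have rD : r ^+ 2 = D by rewrite sqr_sqrtr ?ltW.
rewrite /hypercube_section_volume; set S := [set V | _].
set I := RHS.
have volE (e p : 'rV[R]_m.+1) (Q : 'M[R]_(m, m.+1)) b : sign_vector e ->
    isometric_chart [set x | dot e x = b] p Q ->
    `|b - dot e (hypercube_center m.+1)| = r * t ->
    lebesgue_tuple (affine_map p Q @^-1` ([set x | dot e x = b] `&` @hypercube R m.+1)) = I%:E.
  move=> he ch bt; rewrite (chart_volume he ch) -/D -/r.
  set s := b - _ in bt *.
  rewrite cube_slab_fourier ?(ltnW m1)// -EFinM; congr EFin; rewrite /I.
  rewrite [LHS]mulrA (_ : r * (2 / pi) = 2 * r / pi); last by rewrite mulrA (mulrC r).
  congr (_ * _); apply: eq_Rintegral => u _; congr (_ * _).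
  rewrite -bt /s; case: (ger0P (b - _)) => // _.
  by rewrite mulrN mulNr cosN.
have SI : S I.
  pose e : 'rV[R]_m.+1 := const_mx 1.
  have he : sign_vector e by move=> i; rewrite mxE expr1n.
  have ee : dot e e = D by exact: dot_sign.
  pose c : 'rV[R]_m.+1 := hypercube_center m.+1.
  pose p := c + (t / r) *: e.
  have bE : dot e p - dot e c = r * t.
    by rewrite dotDr dotZr ee addrC addKr -rD; field; rewrite gt_eqF.
  have [Q ch] := @hyperplane_chart R m e p (ltnW m1) he.
  exists [set x | dot e x = dot e p]; split.
  - exists 0, e; split; last by exists (dot e p); rewrite subr0.
    split => i; [left|right|]; rewrite !mxE//.
    by apply/eqP; rewrite eq_sym oner_eq0.
  - rewrite euclidean_dist_hyperplane// -/c bE -/D -/r ger0_norm ?mulr_ge0 ?(ltW r0)//.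
    by rewrite mulrC mulKf// gt_eqF.
  - exists p, Q; split => //.
    by apply: volE => //; rewrite -/c bE ger0_norm// mulr_ge0// ltW.
have SE V : S V -> V = I.
  move=> [H [[v [w [vw [b HE]]]]]] dH [p [Q [ch vol]]].
  move: dH ch vol; rewrite {}HE => dH ch vol.
  have he := opposite_vertices_sign vw.
  have := volE _ _ _ _ he ch; rewrite vol => h.
  apply: (@EFin_inj R); apply: h.
  by rewrite -dH euclidean_dist_hyperplane// -/D -/r mulrC divfK// gt_eqF.
exact: xget_unique SI SE.
Qed.
End SectionVolume.

Theorem theorem3p2 (R : realType) (d : nat) (hd : (136 <= d)%N)
    (t : R) (ht : 0 <= t) :
  `| hypercube_section_volume d t
     - Num.sqrt (6 / pi) * expR (- 6 * t ^+ 2)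
       * (1 - (3 - 72 * t ^+ 2 + 144 * t ^+ 4) / (20 * d%:R)) |
  < 1 / (d%:R `^ (3 / 2)).
Proof.
have := sinc_integral_edgeworth hd t; case: d hd => // m hd.
by rewrite -hypercube_section_volumeE //; lia.
Qed.
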